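(* For every odd prime $q$, there is a simple signed graph $\widehat Q_5(q)$ with $\mathrm{DC}(\widehat Q_5(q))\cong B_5(q)[4]$, $$v(\widehat Q_5(q))=\frac{5q^5-q^2-4q}{2},\qquad e(\widehat Q_5(q))=2(q^6-q^3),$$ and containing no $C_{-5}$ and no $C_{+10}$. Consequently, as $n\to\infty$, $$\widehat{\mathrm{ex}}(n,C_{+10})\ \ge\ \left(\frac{4\cdot2^{1/5}}{5^{6/5}}-o(1)\right)n^{6/5}.$$
   Context: All graphs are finite and simple; $v(\cdot)$, $e(\cdot)$ are the numbers of vertices and edges. A signed graph is a pair $\widehat G=(G,\sigma)$ with $\sigma:E(G)\to\{+1,-1\}$; the sign of a cycle is the product of its edge signs, and $C_{+r}$, $C_{-r}$ denote $r$-cycles of sign $+1$, $-1$ respectively. $\widehat{\mathrm{ex}}(n,C_{+10})$ is the maximum number of edges of an $n$-vertex signed graph containing no $C_{+10}$. The double cover $\mathrm{DC}(\widehat G)$ is the ordinary graph on $\{v^+:v\in V(G)\}\sqcup\{v^-:v\in V(G)\}$ in which each positive edge $uv$ gives the edges $u^+v^+$ and $u^-v^-$, and each negative edge $uv$ gives the edges $u^+v^-$ and $u^-v^+$. For an odd prime $q$, $\Gamma_5(q)$ is the bipartite graph with point part $P=\mathbb F_q^5$ and line part $L=\mathbb F_q^5$ (disjoint copies), where $p=(p_1,\dots,p_5)\in P$ is adjacent to $\ell=[\ell_1,\dots,\ell_5]\in L$ when $$p_2+\ell_2=p_1\ell_1,\quad p_3+\ell_3=p_1\ell_2,\quad p_4+\ell_4=p_1\ell_3,\quad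 p_5+\ell_5=p_2\ell_3-p_3\ell_2.$$ $B_5(q)$ is the graph obtained from $\Gamma_5(q)$ by deleting the vertices $P_0\cup L_0$, where $P_0=\{(0,0,a,0,0):a\in\mathbb F_q\}\subseteq P$ and $L_0=\{[b,0,c,0,0]:b,c\in\mathbb F_q\}\subseteq L$. $B_5(q)[4]$ is the one-sided $4$-clone of $B_5(q)$ on the point side: each remaining point is replaced by $4$ pairwise nonadjacent vertices, each with the same line-neighbours as that point. *)

(* Defs.v *)
From HB Require Import structures.
From mathcomp Require Import all_boot all_order all_algebra.
From mathcomp Require Import boolp.

Set Implicit Arguments.
Unset Strict Implicit.
Unset Printing Implicit Defensive.

Import GRing.Theory.

Local Open Scope ring_scope.

Record graph (V : finType) := Graph {
  adj : rel V;
  adj_sym : symmetric adj;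
  adj_irr : irreflexive adj }.

Definition edges (V : finType) (G : graph V) : {set {set V}} :=
  [set [set x; y] | x in V, y in V & adj G x y].

Lemma edgesE (V : finType) (G : graph V) (x y : V) :
  ([set x; y] \in edges G) = adj G x y.
Proof.
apply/imset2P/idP => [[a b _]|xy]; last by exists x y; rewrite ?inE.
rewrite !inE => /andP[_ ab] e.
have : b \in [set x; y] by rewrite e set22.
have : a \in [set x; y] by rewrite e set21.
rewrite !inE => /orP[] /eqP ea /orP[] /eqP eb; rewrite {}ea {}eb in ab => //.
- by rewrite adj_irr in ab.
- by rewrite adj_sym.
- by rewrite adj_irr in ab.
Qed.

Definition graph_iso (V W : finType) (G : graph V) (H : graph W) : Prop :=
  exists2 f : V -> W, bijective f & forall x y, adj H (f x) (f y) = adj G x y.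

(* The values of [sgn] outside [edges G] are irrelevant: they are never used. *)
Record signed_graph (V : finType) := SignedGraph {
  underlying :> graph V;
  sgn : {set V} -> int;
  sgnP : forall e, e \in edges underlying -> sgn e = 1 \/ sgn e = -1 }.

(* A cycle is given by the sequence of its vertices, in cyclic order. *)
Definition is_cycle (V : finType) (G : graph V) (c : seq V) : Prop :=
  (2 < size c)%N /\ ucycle (adj G) c.

Definition cycle_sign (V : finType) (G : signed_graph V) (c : seq V) : int :=
  \prod_(x <- c) sgn G [set x; next c x].

Definition contains_C (V : finType) (s : int) (r : nat) (G : signed_graph V) :
    Prop :=
  exists c : seq V, [/\ is_cycle G c, size c = r & cycle_sign G c = s].

(* [exhat n s r] is the maximum number of edges of an [n]-vertex signed graph
   with no [r]-cycle of sign [s]; the bound on [m] only makes the range of the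
   maximum finite, see [exhat_attained] and [exhat_ub]. *)
Definition exhat (n : nat) (s : int) (r : nat) : nat :=
  \max_(m < 'C(n, 2).+1 |
      `[< exists (V : finType) (G : signed_graph V),
            [/\ #|V| = n, ~ contains_C s r G & #|edges G| = m :> nat] >]) m.

Section DoubleCover.
Variables (V : finType) (G : signed_graph V).

(* [(v, true)] is v^+ and [(v, false)] is v^-. *)
Definition dc_adj : rel (V * bool) := fun x y =>
  adj G x.1 y.1 &&
  (sgn G [set x.1; y.1] == if x.2 == y.2 then 1 else -1).

Lemma dc_adj_sym : symmetric dc_adj.
Proof. by move=> x y; rewrite /dc_adj adj_sym setUC (eq_sym x.2). Qed.

Lemma dc_adj_irr : irreflexive dc_adj.
Proof. by move=> x; rewrite /dc_adj adj_irr. Qed.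

Definition DC : graph (V * bool)%type := Graph dc_adj_sym dc_adj_irr.

End DoubleCover.

(* Bipartite graphs with a point part [P] and a line part [L] are given by
   their incidence relation. *)
Section Bipartite.
Variables (P L : finType) (I : P -> L -> bool).

Definition bip_adj : rel (P + L) := fun x y =>
  match x, y with
  | inl p, inr l => I p l
  | inr l, inl p => I p l
  | _, _ => false
  end.

Lemma bip_adj_sym : symmetric bip_adj.
Proof. by move=> [p|l] [p'|l']. Qed.

Lemma bip_adj_irr : irreflexive bip_adj.
Proof. by move=> [p|l]. Qed.

Definition bipartite : graph (P + L)%type := Graph bip_adj_sym bip_adj_irr.

Definition delete (P0 : {set P}) (L0 : {set L}) :
    {p : P | p \notin P0} -> {l : L | l \notin L0} -> bool :=
  fun p l => I (val p) (val l).

Definition clone (k : nat) : P * 'I_k -> L -> bool := fun p l => I p.1 l.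

End Bipartite.

Definition F5 (q : nat) : finType := 'rV['F_q]_5.

(* Coordinates are numbered from 1 to 5. *)
Definition coord5 (q : nat) (x : F5 q) (i : nat) : 'F_q := x ord0 (inord i.-1).

Definition Gamma5 (q : nat) (p l : F5 q) : bool :=
  [&& coord5 p 2 + coord5 l 2 == coord5 p 1 * coord5 l 1,
      coord5 p 3 + coord5 l 3 == coord5 p 1 * coord5 l 2,
      coord5 p 4 + coord5 l 4 == coord5 p 1 * coord5 l 3 &
      coord5 p 5 + coord5 l 5 == coord5 p 2 * coord5 l 3 - coord5 p 3 * coord5 l 2].

Definition P0 (q : nat) : {set F5 q} :=
  [set p | [&& coord5 p 1 == 0, coord5 p 2 == 0, coord5 p 4 == 0 & coord5 p 5 == 0]].

Definition L0 (q : nat) : {set F5 q} :=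
  [set l | [&& coord5 l 2 == 0, coord5 l 4 == 0 & coord5 l 5 == 0]].

Definition B5 (q : nat) := @delete _ _ (@Gamma5 q) (P0 q) (L0 q).

Definition B5_clone4 (q : nat) := bipartite (@clone _ _ (@B5 q) 4).

Lemma card_edges (V : finType) (G : graph V) : (#|edges G| <= 'C(#|V|, 2))%N.
Proof.
rewrite -card_draws; apply/subset_leq_card/subsetP => e /imset2P[x y _].
rewrite !inE => /andP[_ xy] ->; rewrite cards2.
by have [eq_xy|//] := eqVneq x y; rewrite eq_xy adj_irr in xy.
Qed.

Lemma exhat_ub (n : nat) (s : int) (r : nat) (V : finType)
    (G : signed_graph V) :
  #|V| = n -> ~ contains_C s r G -> (#|edges G| <= exhat n s r)%N.
Proof.
move=> Vn Gfree; have lt_e : (#|edges G| < 'C(n, 2).+1)%N.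
  by rewrite ltnS -Vn card_edges.
rewrite /exhat (bigmax_sup (Ordinal lt_e)) //.
by apply/asboolP; exists V, G.
Qed.

Lemma exhat_attained (n : nat) (s : int) (r : nat) :
  exists (V : finType) (G : signed_graph V),
    [/\ #|V| = n, ~ contains_C s r G & #|edges G| = exhat n s r].
Proof.
pose g0 := @Graph 'I_n (fun _ _ => false) (fun _ _ => erefl) (fun _ => erefl).
pose G0 := @SignedGraph _ g0 (fun=> 1) (fun _ _ => or_introl erefl).
have G0e : #|edges G0| = 0%N.
  by apply: eq_card0 => e; apply/imset2P => -[x y _]; rewrite !inE.
have G0P : exists (V : finType) (G : signed_graph V),
    [/\ #|V| = n, ~ contains_C s r G & #|edges G| = 0%N].
  exists _, G0; split=> //; first exact: card_ord.
  by move=> [[|x [|y c]]] [[]].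
rewrite /exhat; apply: (big_rec (fun m => exists (V : finType)
    (G : signed_graph V),
    [/\ #|V| = n, ~ contains_C s r G & #|edges G| = m])) => // i m Pi Pm.
by rewrite /maxn; case: ifP => // _; apply/asboolP.
Qed.

(* Main.v *)
(* Changing the signs of p_1, p_2, p_4, p_5 and of l_2, l_4, l_5 is an
   automorphism of Gamma_5(q) whose fixed vertices are exactly P_0 and L_0.  It
   acts freely on B_5(q)[4], and the signed graph is the quotient.  A positive
   10-cycle lifts to a 10-cycle of B_5(q)[4], which projects to a closed walk
   of Gamma_5(q) through five distinct lines; the increments s_i of l_1 between
   consecutive lines and the first coordinates x_i of the points satisfy
   sum s_i x_i^k = 0 for k <= 3 and sum_(j<i) s_i s_j (x_i - x_j)^3 = 0, which
   forces the five points to coincide, although a point has only four clones.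

   The asymptotic bound for all n needs primes in [x, (1+e)x] for every e > 0
   and x large, which is proved by the Selberg-Erdos method.  With nu the
   measure of mass Lambda(n)/n at log n, a weighted form of Selberg's formula
   reads u nu(u,u+g] + int nu(u-v,u-v+g] dnu(v) = 2gu + O(1), so that
   nu(u,u+g] <= 2g + O(1/u).  If windows of length almost G carry arbitrarily
   little mass but longer ones do not, then behind an almost massless window at
   u nearly all log n are such that (u - log n, u - log n + g] has mass almost
   2g; these windows chain up to a long interval of density almost 2, against
   Mertens' estimate nu(0,t] = t + O(1). *)

Require Import Defs.
From HB Require Import structures.
From mathcomp Require Import all_boot all_order all_algebra.
From mathcomp Require Import boolp classical_sets reals topology normedtype.
From mathcomp Require Import sequences exp.
From mathcomp Require Import zify ring lra.

Set Implicit Arguments.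
Unset Strict Implicit.
Unset Printing Implicit Defensive.

Import Order.TTheory GRing.Theory Num.Theory.
Import numFieldNormedType.Exports.

Local Open Scope ring_scope.

(** * Closed walks of length ten in the graph Gamma_5(q) *)

(** For five distinct x_i the four vanishing moments leave a one-dimensional space of increments, on
    which the skew sum is nonzero. If values coincide, moments alone exclude every pattern but one,
    in which two values interleave; there the skew sum decides again. These are the two places where
    the fifth equation of Gamma_5 acts. The argument needs the five lines of a decagon to be
    distinct while its points may repeat, so the points are cloned and the lines are not. The flip
    keeps points and lines apart, so the quotient is itself bipartite and has no odd cycle of either
    sign. Four copies of the points and one of the lines, halved by the involution, give order about
    5 q^5 / 2 against about 2 q^6 edges; solving for q at order n yields the constant. A bounded
    ratio between consecutive primes would lose a constant factor, hence the need for ratios tending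
    to 1. *)

Section Pentagon.
Variable F : fieldType.
Hypothesis two_neq0 : (2 : F) != 0.

(* For five points of first coordinates x_i, each on two consecutive lines of a
   closed sequence, s_i is the increment of the first coordinate of the lines
   at the i-th point; [pentad_cubic] says that the moments of order at most 3
   vanish, [pentad_skew] is what remains of the fifth equation of Gamma_5, and
   [pentad_adj] that lines at distance two are distinct. *)
Record pentad (x1 s1 x2 s2 x3 s3 x4 s4 x5 s5 : F) : Prop := Pentad {
  pentad_cubic : forall a b c,
    s1 * ((x1 - a) * (x1 - b) * (x1 - c)) + s2 * ((x2 - a) * (x2 - b) * (x2 - c)) +
    s3 * ((x3 - a) * (x3 - b) * (x3 - c)) + s4 * ((x4 - a) * (x4 - b) * (x4 - c)) +
    s5 * ((x5 - a) * (x5 - b) * (x5 - c)) = 0;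
  pentad_skew :
    s2 * s1 * (x2 - x1) ^+ 3 + s3 * s1 * (x3 - x1) ^+ 3 + s3 * s2 * (x3 - x2) ^+ 3 +
    s4 * s1 * (x4 - x1) ^+ 3 + s4 * s2 * (x4 - x2) ^+ 3 + s4 * s3 * (x4 - x3) ^+ 3 +
    s5 * s1 * (x5 - x1) ^+ 3 + s5 * s2 * (x5 - x2) ^+ 3 + s5 * s3 * (x5 - x3) ^+ 3 +
    s5 * s4 * (x5 - x4) ^+ 3 = 0;
  pentad_neq0 : [/\ s1 != 0, s2 != 0, s3 != 0, s4 != 0 & s5 != 0];
  pentad_adj : [/\ x1 = x2 -> s1 + s2 != 0, x2 = x3 -> s2 + s3 != 0,
    x3 = x4 -> s3 + s4 != 0, x4 = x5 -> s4 + s5 != 0 & x5 = x1 -> s5 + s1 != 0] }.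

(** Moving the first point to the end reverses the terms s_1 s_j (x_j - x_1)^3, whose sum is s_1
    times the cubic identity at a = b = c = x_1. Each pattern of coincidences then needs treatment
    in one cyclic position only. *)
Lemma pentad_rot x1 s1 x2 s2 x3 s3 x4 s4 x5 s5 :
  pentad x1 s1 x2 s2 x3 s3 x4 s4 x5 s5 -> pentad x2 s2 x3 s3 x4 s4 x5 s5 x1 s1.
Proof.
move=> [cub skew [? ? ? ? ?] [? ? ? ? ?]]; split=> //.
  by move=> a b c; rewrite -[RHS](cub a b c); ring.
have comb a b : a = 0 -> b = 0 -> a - 2 * s1 * b = 0 by move=> -> ->;
  rewrite mulr0 subr0.
by rewrite -[RHS](comb _ _ skew (cub x1 x1 x1)); ring.
Qed.

Lemma pentad_not_distinct x1 s1 x2 s2 x3 s3 x4 s4 x5 s5 :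
  pentad x1 s1 x2 s2 x3 s3 x4 s4 x5 s5 ->
  x1 != x2 -> x1 != x3 -> x1 != x4 -> x1 != x5 -> x2 != x3 -> x2 != x4 ->
  x2 != x5 -> x3 != x4 -> x3 != x5 -> x4 != x5 -> False.
Proof.
move=> [cub skew [_ _ _ _ s50] _].
rewrite -(subr_eq0 x1 x2) -(subr_eq0 x1 x3) -(subr_eq0 x1 x4) -(subr_eq0 x1 x5)
  -(subr_eq0 x2 x3) -(subr_eq0 x2 x4) -(subr_eq0 x2 x5) -(subr_eq0 x3 x4) -(subr_eq0 x3
  x5) -(subr_eq0 x4 x5) => n12 n13 n14 n15 n23 n24 n25 n34 n35 n45.
(* The moments determine s_i = c / prod_(j != i) (x_i - x_j), and then the skew
   sum equals - 2 c^2 / prod_i (x_i - x_(i+2)). *)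
pose c := s5 * ((x1 - x5) * (x2 - x5) * (x3 - x5) * (x4 - x5)).
have e1 : s1 = c / ((x1 - x2) * (x1 - x3) * (x1 - x4) * (x1 - x5)).
  apply/eqP; rewrite -subr_eq0; apply/eqP.
  transitivity ((s1 * ((x1 - x2) * (x1 - x3) * (x1 - x4)) + s5 * ((x5 - x2) * (x5 - x3)
    * (x5 - x4))) / ((x1 - x2) * (x1 - x3) * (x1 - x4))).
    by rewrite /c; field; rewrite n12 n13 n14 n15.
  by rewrite (_ : _ + _ = 0) ?mul0r // -[RHS](cub x2 x3 x4); ring.
have e2 : s2 = - c / ((x1 - x2) * (x2 - x3) * (x2 - x4) * (x2 - x5)).
  apply/eqP; rewrite -subr_eq0; apply/eqP.
  transitivity ((s2 * ((x2 - x1) * (x2 - x3) * (x2 - x4)) + s5 * ((x5 - x1) * (x5 - x3)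
    * (x5 - x4))) / ((x2 - x1) * (x2 - x3) * (x2 - x4))).
    by rewrite /c; field; rewrite -(opprB x1 x2) oppr_eq0 n12 n23 n24 n25.
  by rewrite (_ : _ + _ = 0) ?mul0r // -[RHS](cub x1 x3 x4); ring.
have e3 : s3 = c / ((x1 - x3) * (x2 - x3) * (x3 - x4) * (x3 - x5)).
  apply/eqP; rewrite -subr_eq0; apply/eqP.
  transitivity ((s3 * ((x3 - x1) * (x3 - x2) * (x3 - x4)) + s5 * ((x5 - x1) * (x5 - x2)
    * (x5 - x4))) / ((x3 - x1) * (x3 - x2) * (x3 - x4))).
    by rewrite /c; field; rewrite -(opprB x1 x3) -(opprB x2 x3) !oppr_eq0 n13 n23 n34
      n35.
  by rewrite (_ : _ + _ = 0) ?mul0r // -[RHS](cub x1 x2 x4); ring.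
have e4 : s4 = - c / ((x1 - x4) * (x2 - x4) * (x3 - x4) * (x4 - x5)).
  apply/eqP; rewrite -subr_eq0; apply/eqP.
  transitivity ((s4 * ((x4 - x1) * (x4 - x2) * (x4 - x3)) + s5 * ((x5 - x1) * (x5 - x2)
    * (x5 - x3))) / ((x4 - x1) * (x4 - x2) * (x4 - x3))).
    by rewrite /c; field; rewrite -(opprB x1 x4) -(opprB x2 x4) -(opprB x3 x4)
      !oppr_eq0 n14 n24 n34 n45.
  by rewrite (_ : _ + _ = 0) ?mul0r // -[RHS](cub x1 x2 x3); ring.
have e5 : s5 = c / ((x1 - x5) * (x2 - x5) * (x3 - x5) * (x4 - x5)).
  by rewrite /c mulfK // !mulf_neq0.
have c0 : c != 0 by rewrite !mulf_neq0.
move: c c0 e1 e2 e3 e4 e5 skew => c c0 -> -> -> -> ->;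
  clear -c0 two_neq0 n12 n13 n14 n15 n23 n24 n25 n34 n35 n45.
move=> skew.
have : - (2 * c ^+ 2) / ((x1 - x3) * (x2 - x4) * (x3 - x5) * (x1 - x4) * (x2 - x5)) = 0.
  rewrite -[RHS]skew; field.
  by rewrite n12 n13 n14 n15 n23 n24 n25 n34 n35 n45.
apply/eqP; rewrite mulNr oppr_eq0 !mulf_neq0 ?expf_neq0 // invr_neq0 //.
by rewrite !mulf_neq0.
Qed.

(** Since the x_i are not all distinct, an isolated x1 leaves at most three values to the others,
    and the cubic vanishing at these values kills every term except the nonzero first one. Up to
    rotation, every value thus occurs at least twice. *)
Lemma pentad_not_isolated x1 s1 x2 s2 x3 s3 x4 s4 x5 s5 :
  pentad x1 s1 x2 s2 x3 s3 x4 s4 x5 s5 ->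
  [\/ x1 = x2, x1 = x3, x1 = x4 | x1 = x5].
Proof.
move=> pent; have [cub _ [s10 _ _ _ _] _] := pent.
have [->|n12] := eqVneq x1 x2; first exact: Or41.
have [->|n13] := eqVneq x1 x3; first exact: Or42.
have [->|n14] := eqVneq x1 x4; first exact: Or43.
have [->|n15] := eqVneq x1 x5; first exact: Or44.
exfalso.
have nz a b c : x1 != a -> x1 != b -> x1 != c -> s1 * ((x1 - a) * (x1 - b) * (x1 - c))
  != 0.
  by move=> *; rewrite !mulf_neq0 ?subr_eq0.
have contra a b c : x1 != a -> x1 != b -> x1 != c ->
    ~ (s1 * ((x1 - a) * (x1 - b) * (x1 - c)) = 0).
  by move=> na nb nc e; have := nz a b c na nb nc; rewrite e eqxx.
apply: (pentad_not_distinct pent) => //; apply/eqP => e;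
  rewrite e in cub n12 n13 n14 n15 contra.
- by apply: (contra x3 x4 x5) => //; rewrite -[RHS](cub x3 x4 x5); ring.
- by apply: (contra x3 x4 x5) => //; rewrite -[RHS](cub x3 x4 x5); ring.
- by apply: (contra x3 x4 x5) => //; rewrite -[RHS](cub x3 x4 x5); ring.
- by apply: (contra x2 x4 x5) => //; rewrite -[RHS](cub x2 x4 x5); ring.
- by apply: (contra x2 x4 x5) => //; rewrite -[RHS](cub x2 x4 x5); ring.
- by apply: (contra x2 x3 x5) => //; rewrite -[RHS](cub x2 x3 x5); ring.
Qed.

(** Pattern AABBB: the cubic with triple root x3 leaves (s1 + s2) (x1 - x3)^3, and [pentad_adj]
    makes s1 + s2 nonzero. *)
Lemma pentad_adjacent_pair x1 s1 x2 s2 x3 s3 x4 s4 x5 s5 :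
  pentad x1 s1 x2 s2 x3 s3 x4 s4 x5 s5 ->
  x1 = x2 -> x3 = x4 -> x4 = x5 -> x1 = x3.
Proof.
move=> [cub _ _ [+ _ _ _ _]] e1 e2 e3 => /(_ e1) s12.
rewrite -e3 -e2 -e1 in cub; apply/eqP/negPn/negP; rewrite -subr_eq0 => n.
have : (s1 + s2) * (x1 - x3) ^+ 3 = 0 by rewrite -[RHS](cub x3 x3 x3); ring.
by apply/eqP; rewrite mulf_neq0 // expf_neq0.
Qed.

(** Pattern ABABB: the moments only give s1 + s3 = 0 and s2 + s4 + s5 = 0, which is consistent with
    [pentad_adj]. The skew sum then reduces to - 2 s1 s2 (x1 - x2)^3. *)
Lemma pentad_split_pair x1 s1 x2 s2 x3 s3 x4 s4 x5 s5 :
  pentad x1 s1 x2 s2 x3 s3 x4 s4 x5 s5 ->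
  x1 = x3 -> x2 = x4 -> x4 = x5 -> x1 = x2.
Proof.
move=> [cub skew [s10 s20 _ _ _] _] e1 e2 e3.
rewrite -e3 -e2 -e1 in cub skew; apply/eqP/negPn/negP; rewrite -subr_eq0 => n.
have n3 : (x1 - x2) ^+ 3 != 0 by rewrite expf_neq0.
have s13 : s1 + s3 = 0.
  by apply: (mulIf n3); rewrite mul0r -[RHS](cub x2 x2 x2); ring.
have s245 : s2 + s4 + s5 = 0.
  by apply: (mulIf n3); rewrite mul0r -[RHS]oppr0 -[in RHS](cub x1 x1 x1); ring.
have : 2 * s1 * s2 * (x1 - x2) ^+ 3 = 0.
  have s3E : s3 = - s1 by apply/eqP; rewrite -addr_eq0 addrC s13.
  have s5E : s5 = - (s2 + s4) by apply/eqP; rewrite -addr_eq0 addrC s245.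
  by rewrite s3E s5E in skew; rewrite -[RHS]oppr0 -[in RHS]skew; ring.
by apply/eqP; rewrite !mulf_neq0.
Qed.

(** Two values, each occurring at least twice, split the five positions as 2 + 3; up to rotation the
    pair is adjacent or split, and both patterns are excluded. *)
Lemma pentad_const_adj x1 s1 x2 s2 x3 s3 x4 s4 x5 s5 :
  pentad x1 s1 x2 s2 x3 s3 x4 s4 x5 s5 -> x4 = x5 ->
  [/\ x1 = x2, x2 = x3, x3 = x4 & x4 = x5].
Proof.
move=> p1; have p2 := pentad_rot p1; have p3 := pentad_rot p2.
have p4 := pentad_rot p3; have p5 := pentad_rot p4 => e.
have A12 := pentad_adjacent_pair p1; have A23 := pentad_adjacent_pair p2.
have A45 := pentad_adjacent_pair p4; have G13 := pentad_split_pair p1.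
have N1 := pentad_not_isolated p1; have N2 := pentad_not_isolated p2.
have N3 := pentad_not_isolated p3.
suff : x1 = x5 /\ x2 = x5 /\ x3 = x5 by move=> [? [? ?]]; split; congruence.
subst x5; have [e1|n1] := eqVneq x1 x4.
  subst x1; have [e2|/eqP n2] := eqVneq x2 x4.
    by subst x2; case: N3 => *; do ! split; congruence.
  have e23 : x2 = x3 by case: N2; congruence.
  by have := A23 e23 erefl erefl; congruence.
move/eqP in n1.
have [e2|/eqP n2] := eqVneq x1 x2.
  subst x2; have [e3|/eqP n3] := eqVneq x3 x4.
    by have := A12 erefl e3 erefl; congruence.
  have e13 : x1 = x3 by case: N3; congruence.
  by have := A45 erefl erefl e13; congruence.
have e13 : x1 = x3 by case: N1; congruence.
have e24 : x2 = x4 by case: N2; congruence.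
by have := G13 e13 e24 erefl; congruence.
Qed.

Lemma pentad_const x1 s1 x2 s2 x3 s3 x4 s4 x5 s5 :
  pentad x1 s1 x2 s2 x3 s3 x4 s4 x5 s5 ->
  [/\ x1 = x2, x2 = x3, x3 = x4 & x4 = x5].
Proof.
move=> p1; have p2 := pentad_rot p1; have p3 := pentad_rot p2.
have p4 := pentad_rot p3; have p5 := pentad_rot p4.
have [e|/eqP n45] := eqVneq x4 x5; first exact: pentad_const_adj p1 e.
have [e|/eqP n51] := eqVneq x5 x1; first by have [] := pentad_const_adj p2 e; split;
  congruence.
have [e|/eqP n12] := eqVneq x1 x2; first by have [] := pentad_const_adj p3 e; split;
  congruence.
have [e|/eqP n23] := eqVneq x2 x3; first by have [] := pentad_const_adj p4 e; split;
  congruence.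
have [e|/eqP n34] := eqVneq x3 x4; first by have [] := pentad_const_adj p5 e; split;
  congruence.
(* Equal values now lie at cyclic distance two, so no value occurs three times; each occurring
   exactly twice is impossible for five positions. *)
exfalso.
have N1 := pentad_not_isolated p1; have N2 := pentad_not_isolated p2.
have N3 := pentad_not_isolated p3; have N4 := pentad_not_isolated p4.
have N5 := pentad_not_isolated p5.
have [e13|/eqP n13] := eqVneq x1 x3.
  have e24 : x4 = x2 by case: N4; congruence.
  by case: N5; congruence.
have e14 : x1 = x4 by case: N1; congruence.
have e35 : x3 = x5 by case: N3; congruence.
by case: N2; congruence.
Qed.

End Pentagon.

(** * Moment equations along a closed sequence of lines *)

Section LineCycles.
Variable F : fieldType.

(** Passing to another line through a point of first coordinate x changes (a, b, c, d) by s (1, x,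
    x^2, x^3) with s = a' - a. A cubic in x times s is thus a combination of increments, which
    telescope around the cycle. *)
Lemma line_increment (x a a' b b' c c' d d' u v w : F) :
  b' - b = x * (a' - a) -> c' - c = x * (b' - b) -> d' - d = x * (c' - c) ->
  (a' - a) * ((x - u) * (x - v) * (x - w)) =
  (d' - d) - (u + v + w) * (c' - c) + (u * v + v * w + w * u) * (b' - b) - u * v * w *
    (a' - a).
Proof. by move=> hb hc hd; rewrite hd hc hb; ring. Qed.

(** Eliminating p_2 and p_3 turns the fifth equation of Gamma_5 into p_5 + l_5 = p_1 (l_1 l_3 -
    l_2^2); this is the origin of the form a c - b^2. *)
Lemma quadric_increment (x a a' b b' c c' e e' : F) :
  b' - b = x * (a' - a) -> c' - c = x * (b' - b) ->
  e' - e = x * ((a' * c' - b' ^+ 2) - (a * c - b ^+ 2)) ->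
  e' - e = (a' - a) * x * (a * x ^+ 2 + c - 2 * b * x).
Proof.
move=> hb hc ->; have -> : a' = a + (a' - a) by ring.
move: hb hc; set s := a' - a => hb hc.
have -> : c' = c + x * (x * s) by rewrite -hb -hc; ring.
have -> : b' = b + x * s by rewrite -hb; ring.
ring.
Qed.

(** Up to moments, the last hypothesis is the sum over j < i of s_i s_j x_i (x_i - x_j)^2. Writing 2
    x_i = (x_i - x_j) + (x_i + x_j) splits its double into the skew sum and a symmetric part, which
    equals M3 M0 - M1 M2 in terms of the moments M_k. *)
Lemma skew_of_quadric (a b c x1 s1 x2 s2 x3 s3 x4 s4 x5 s5 : F) :
  s1 + s2 + s3 + s4 + s5 = 0 ->
  s1 * x1 + s2 * x2 + s3 * x3 + s4 * x4 + s5 * x5 = 0 ->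
  s1 * x1 ^+ 2 + s2 * x2 ^+ 2 + s3 * x3 ^+ 2 + s4 * x4 ^+ 2 + s5 * x5 ^+ 2 = 0 ->
  s1 * x1 ^+ 3 + s2 * x2 ^+ 3 + s3 * x3 ^+ 3 + s4 * x4 ^+ 3 + s5 * x5 ^+ 3 = 0 ->
  let q s a b c x := s * x * (a * x ^+ 2 + c - 2 * b * x) in
  q s1 a b c x1 +
  q s2 (a + s1) (b + s1 * x1) (c + s1 * x1 ^+ 2) x2 +
  q s3 (a + s1 + s2) (b + s1 * x1 + s2 * x2) (c + s1 * x1 ^+ 2 + s2 * x2 ^+ 2) x3 +
  q s4 (a + s1 + s2 + s3) (b + s1 * x1 + s2 * x2 + s3 * x3)
    (c + s1 * x1 ^+ 2 + s2 * x2 ^+ 2 + s3 * x3 ^+ 2) x4 +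
  q s5 (a + s1 + s2 + s3 + s4) (b + s1 * x1 + s2 * x2 + s3 * x3 + s4 * x4)
    (c + s1 * x1 ^+ 2 + s2 * x2 ^+ 2 + s3 * x3 ^+ 2 + s4 * x4 ^+ 2) x5 = 0 ->
  s2 * s1 * (x2 - x1) ^+ 3 + s3 * s1 * (x3 - x1) ^+ 3 + s3 * s2 * (x3 - x2) ^+ 3 +
  s4 * s1 * (x4 - x1) ^+ 3 + s4 * s2 * (x4 - x2) ^+ 3 + s4 * s3 * (x4 - x3) ^+ 3 +
  s5 * s1 * (x5 - x1) ^+ 3 + s5 * s2 * (x5 - x2) ^+ 3 + s5 * s3 * (x5 - x3) ^+ 3 +
  s5 * s4 * (x5 - x4) ^+ 3 = 0.
Proof.
move=> m0 m1 m2 m3 q hq.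
have comb M0 M1 M2 M3 T : M0 = 0 -> M1 = 0 -> M2 = 0 -> M3 = 0 -> T = 0 ->
    2 * T - (M3 * M0 - M1 * M2) - 2 * (a * M3 + c * M1 - 2 * b * M2) = 0.
  by move=> -> -> -> -> ->; ring.
by rewrite -[RHS](comb _ _ _ _ _ m0 m1 m2 m3 hq) /q; ring.
Qed.

Lemma line_pentad (x1 x2 x3 x4 x5 a1 a2 a3 a4 a5 b1 b2 b3 b4 b5
    c1 c2 c3 c4 c5 d1 d2 d3 d4 d5 e1 e2 e3 e4 e5 : F) :
  let step x a a' b b' c c' d d' e e' :=
    [/\ b' - b = x * (a' - a), c' - c = x * (b' - b), d' - d = x * (c' - c) &
      e' - e = x * ((a' * c' - b' ^+ 2) - (a * c - b ^+ 2))] in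
  step x1 a1 a2 b1 b2 c1 c2 d1 d2 e1 e2 -> step x2 a2 a3 b2 b3 c2 c3 d2 d3 e2 e3 ->
  step x3 a3 a4 b3 b4 c3 c4 d3 d4 e3 e4 -> step x4 a4 a5 b4 b5 c4 c5 d4 d5 e4 e5 ->
  step x5 a5 a1 b5 b1 c5 c1 d5 d1 e5 e1 ->
  [/\ a2 - a1 != 0, a3 - a2 != 0, a4 - a3 != 0, a5 - a4 != 0 & a1 - a5 != 0] ->
  [/\ x1 = x2 -> a3 - a1 != 0, x2 = x3 -> a4 - a2 != 0,
    x3 = x4 -> a5 - a3 != 0, x4 = x5 -> a1 - a4 != 0 & x5 = x1 -> a2 - a5 != 0] ->
  pentad x1 (a2 - a1) x2 (a3 - a2) x3 (a4 - a3) x4 (a5 - a4) x5 (a1 - a5).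
Proof.
move=> step [hb1 hc1 hd1 he1] [hb2 hc2 hd2 he2] [hb3 hc3 hd3 he3]
  [hb4 hc4 hd4 he4] [hb5 hc5 hd5 he5] nz [n1 n2 n3 n4 n5].
have cub u v w := (line_increment u v w hb1 hc1 hd1, line_increment u v w hb2 hc2 hd2,
  line_increment u v w hb3 hc3 hd3, line_increment u v w hb4 hc4 hd4,
  line_increment u v w hb5 hc5 hd5).
split=> //; last first.
- have tele a b c : (b - a) + (c - b) = c - a :> F by ring.
  by rewrite !tele.
- have qd1 := quadric_increment hb1 hc1 he1; have qd2 := quadric_increment hb2 hc2 he2.
  have qd3 := quadric_increment hb3 hc3 he3; have qd4 := quadric_increment hb4 hc4 he4.
  have qd5 := quadric_increment hb5 hc5 he5.
  apply: (@skew_of_quadric a1 b1 c1).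
  + by ring.
  + by rewrite ![(_ - _) * _]mulrC -hb1 -hb2 -hb3 -hb4 -hb5; ring.
  + have sq x a b : (b - a) * x ^+ 2 = x * (x * (b - a)) :> F by ring.
    by rewrite !sq -hb1 -hb2 -hb3 -hb4 -hb5 -hc1 -hc2 -hc3 -hc4 -hc5; ring.
  + have cu x a b : (b - a) * x ^+ 3 = x * (x * (x * (b - a))) :> F by ring.
    rewrite !cu -hb1 -hb2 -hb3 -hb4 -hb5 -hc1 -hc2 -hc3 -hc4 -hc5.
    by rewrite -hd1 -hd2 -hd3 -hd4 -hd5; ring.
  have A a a' : a + (a' - a) = a' :> F by ring.
  have B x a a' b b' : b' - b = x * (a' - a) -> b + (a' - a) * x = b' :> F.
    by move=> h; rewrite mulrC -h; ring.
  have C x a a' b b' c c' : b' - b = x * (a' - a) -> c' - c = x * (b' - b) ->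
      c + (a' - a) * x ^+ 2 = c' :> F.
    by move=> h h'; rewrite (_ : _ * _ = c' - c) ?A // h' h; ring.
  rewrite /= !A (B _ _ _ _ _ hb1) (B _ _ _ _ _ hb2) (B _ _ _ _ _ hb3) (B _ _ _ _ _ hb4).
  rewrite (C _ _ _ _ _ _ _ hb1 hc1) (C _ _ _ _ _ _ _ hb2 hc2).
  rewrite (C _ _ _ _ _ _ _ hb3 hc3) (C _ _ _ _ _ _ _ hb4 hc4).
  by rewrite -qd1 -qd2 -qd3 -qd4 -qd5; ring.
- by move=> u v w; rewrite !cub; ring.
Qed.

End LineCycles.

(** * Incidence in Gamma_5(q) *)

Section Gamma.
Variable q : nat.
Hypothesis q_prime : prime q.
Implicit Types p l x y : F5 q.

Lemma Gamma5P p l : reflect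
  [/\ coord5 p 2 = coord5 p 1 * coord5 l 1 - coord5 l 2,
      coord5 p 3 = coord5 p 1 * coord5 l 2 - coord5 l 3,
      coord5 p 4 = coord5 p 1 * coord5 l 3 - coord5 l 4 &
      coord5 p 5 = coord5 p 2 * coord5 l 3 - coord5 p 3 * coord5 l 2 - coord5 l 5]
  (Gamma5 p l).
Proof.
rewrite /Gamma5; apply: (iffP and4P).
  by move=> [/eqP <- /eqP <- /eqP <- /eqP <-]; rewrite !addrK.
move=> [h2 h3 h4 h5]; split; apply/eqP; [by rewrite h2; ring | by rewrite h3; ring
  | by rewrite h4; ring | by rewrite h5; ring].
Qed.

Lemma coord5_inj x y : coord5 x 1 = coord5 y 1 -> coord5 x 2 = coord5 y 2 ->
  coord5 x 3 = coord5 y 3 -> coord5 x 4 = coord5 y 4 -> coord5 x 5 = coord5 y 5 -> x =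
    y.
Proof.
move=> h1 h2 h3 h4 h5; apply/rowP => i.
have -> : i = inord i by rewrite inord_val.
by case: i => [[|[|[|[|[|]]]]] hi].
Qed.

Lemma Gamma5_line_inj p l l' : Gamma5 p l -> Gamma5 p l' ->
  coord5 l 1 = coord5 l' 1 -> l = l'.
Proof.
move=> /Gamma5P[a2 a3 a4 a5] /Gamma5P[b2 b3 b4 b5] h1.
have h2 : coord5 l 2 = coord5 l' 2.
  by apply: oppr_inj; apply: (addrI (coord5 p 1 * coord5 l 1)); rewrite -a2 h1 -b2.
have h3 : coord5 l 3 = coord5 l' 3.
  by apply: oppr_inj; apply: (addrI (coord5 p 1 * coord5 l 2)); rewrite -a3 h2 -b3.
have h4 : coord5 l 4 = coord5 l' 4.
  by apply: oppr_inj; apply: (addrI (coord5 p 1 * coord5 l 3)); rewrite -a4 h3 -b4.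
apply: coord5_inj => //; apply: oppr_inj.
by apply: (addrI (coord5 p 2 * coord5 l 3 - coord5 p 3 * coord5 l 2));
  rewrite -a5 h2 h3 -b5.
Qed.

Lemma Gamma5_point_inj p p' l : Gamma5 p l -> Gamma5 p' l ->
  coord5 p 1 = coord5 p' 1 -> p = p'.
Proof.
move=> /Gamma5P[a2 a3 a4 a5] /Gamma5P[b2 b3 b4 b5] h1.
have h2 : coord5 p 2 = coord5 p' 2 by rewrite a2 b2 h1.
have h3 : coord5 p 3 = coord5 p' 3 by rewrite a3 b3 h1.
by apply: coord5_inj => //; rewrite ?a4 ?a5 ?b4 ?b5 ?h1 ?h2 ?h3.
Qed.

Lemma two_neq0_Fp : odd q -> (2 : 'F_q) != 0.
Proof.
move=> q_odd; rewrite -(dvdn_pcharf (pchar_Fp q_prime)).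
by rewrite dvdn_prime2 //; apply: contraTneq q_odd => ->.
Qed.

Lemma Gamma5_pentagon p1 p2 p3 p4 p5 l1 l2 l3 l4 l5 : odd q ->
  Gamma5 p1 l1 -> Gamma5 p1 l2 -> Gamma5 p2 l2 -> Gamma5 p2 l3 ->
  Gamma5 p3 l3 -> Gamma5 p3 l4 -> Gamma5 p4 l4 -> Gamma5 p4 l5 ->
  Gamma5 p5 l5 -> Gamma5 p5 l1 -> uniq [:: l1; l2; l3; l4; l5] ->
  [/\ p1 = p2, p2 = p3, p3 = p4 & p4 = p5].
Proof.
move=> q_odd i11 i12 i22 i23 i33 i34 i44 i45 i55 i51.
rewrite /= !inE !negb_or !andbT => /and4P[/and4P[n12 n13 n14 n15] /and3P[n23 n24 n25]
  /andP[n34 n35] n45].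
have step p l l' : Gamma5 p l -> Gamma5 p l' ->
  [/\ coord5 l' 2 - coord5 l 2 = coord5 p 1 * (coord5 l' 1 - coord5 l 1),
    coord5 l' 3 - coord5 l 3 = coord5 p 1 * (coord5 l' 2 - coord5 l 2),
    coord5 l' 4 - coord5 l 4 = coord5 p 1 * (coord5 l' 3 - coord5 l 3) &
    coord5 l' 5 - coord5 l 5 = coord5 p 1 *
      ((coord5 l' 1 * coord5 l' 3 - coord5 l' 2 ^+ 2) -
       (coord5 l 1 * coord5 l 3 - coord5 l 2 ^+ 2))].
  move=> /Gamma5P[a2 a3 a4 a5] /Gamma5P[b2 b3 b4 b5].
  have sw (P L L' Q Q' : 'F_q) : P = Q - L -> P = Q' - L' -> L' - L = Q' - Q.
    by move=> -> e; rewrite -[L' in LHS](subKr Q') -e; ring.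
  split; [rewrite (sw _ _ _ _ _ a2 b2) | rewrite (sw _ _ _ _ _ a3 b3)
    | rewrite (sw _ _ _ _ _ a4 b4) | rewrite (sw _ _ _ _ _ a5 b5)]; try ring.
  by rewrite {1}b2 {1}b3 a2 a3; ring.
have ne p l l' : Gamma5 p l -> Gamma5 p l' -> l != l' -> coord5 l' 1 - coord5 l 1 != 0.
  move=> il il'; apply: contraNneq => /eqP; rewrite subr_eq0 => /eqP e.
  by apply/eqP/esym; exact: Gamma5_line_inj il' il e.
(* Consecutive points share the line [m], so equal first coordinates make them one point; the outer
   lines both pass through it and differ in their first coordinate. *)
have ne2 p p' l m l' : Gamma5 p l -> Gamma5 p m -> Gamma5 p' m -> Gamma5 p' l' ->
    l != l' -> coord5 p 1 = coord5 p' 1 -> coord5 l' 1 - coord5 l 1 != 0.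
  move=> il im im' il' nl e; have pp := Gamma5_point_inj im im' e.
  by apply: (ne p) => //; rewrite pp.
have pent := line_pentad (step _ _ _ i11 i12) (step _ _ _ i22 i23)
  (step _ _ _ i33 i34) (step _ _ _ i44 i45) (step _ _ _ i55 i51).
have [||e1 e2 e3 e4] := pentad_const (two_neq0_Fp q_odd) (pent _ _).
- by split; [apply: ne i11 i12 _ | apply: ne i22 i23 _ | apply: ne i33 i34 _
    | apply: ne i44 i45 _ | apply: ne i55 i51 _] => //; rewrite eq_sym.
- by split; [apply: ne2 i11 i12 i22 i23 _ | apply: ne2 i22 i23 i33 i34 _
   | apply: ne2 i33 i34 i44 i45 _ | apply: ne2 i44 i45 i55 i51 _
   | apply: ne2 i55 i51 i11 i12 _] => //; rewrite eq_sym.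
by split; [exact: Gamma5_point_inj i12 i22 e1 | exact: Gamma5_point_inj i23 i33 e2
  | exact: Gamma5_point_inj i34 i44 e3 | exact: Gamma5_point_inj i45 i55 e4].
Qed.

End Gamma.

(** * Quotient of a graph by a free involution *)

Lemma sum_adj_edges (V : finType) (G : graph V) :
  (\sum_x \sum_y adj G x y = 2 * #|edges G|)%N.
Proof.
rewrite pair_big /= (eq_bigr (fun z => if adj G z.1 z.2 then 1 else 0)%N); last first.
  by move=> z _; case: adj.
rewrite -big_mkcond /= (partition_big (fun z => [set z.1; z.2]) [in edges G]) /=;
  last first.
  by move=> z; rewrite edgesE.
transitivity (\sum_(e in edges G) 2)%N; last by rewrite sum_nat_const mulnC.
apply: eq_bigr => e /imset2P[a b _].
rewrite !inE => /andP[_ ab] ->; have nab : a != b by apply: contraTneq ab => ->;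
  rewrite adj_irr.
rewrite sum1dep_card (_ : [set x | _] = [set (a, b); (b, a)]); last first.
  apply/setP => -[x y]; rewrite !inE /= !xpair_eqE; apply/andP/orP => [[xy /eqP e2]|].
    have : x \in [set a; b] by rewrite -e2 set21.
    have : y \in [set a; b] by rewrite -e2 set22.
    rewrite !inE => /orP[] /eqP ey /orP[] /eqP ex; subst x y;
      rewrite ?eqxx ?adj_irr // in xy *.
      by right.
    by left.
  move=> [] /andP[/eqP-> /eqP->]; first by split.
  by rewrite adj_sym finset.setUC.
by rewrite cards2 xpair_eqE (negbTE nab).
Qed.

Section FreeInvolution.
Variables (W : finType) (H : graph W) (io : W -> W).
Hypothesis ioK : involutive io.
Hypothesis io_free : forall w, io w != w.
Hypothesis io_adj : forall u v, adj H (io u) (io v) = adj H u v.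
Hypothesis io_loop : forall w, ~~ adj H w (io w).
Hypothesis io_simple : forall u v, adj H u v -> ~~ adj H u (io v).

(** An arbitrary choice of one element per orbit; the chosen elements form the sheet v^+ of the
    double cover. *)
Definition rep w := (enum_rank w < enum_rank (io w))%N.

Lemma rep_io w : rep (io w) = ~~ rep w.
Proof.
rewrite /rep ioK -leqNgt ltn_neqAle (inj_eq val_inj) (inj_eq enum_rank_inj).
by rewrite io_free.
Qed.

Definition quot : finType := {w : W | rep w}.

Lemma rep_canon w : rep (if rep w then w else io w).
Proof. by case: ifP => // h; rewrite rep_io h. Qed.

Definition proj w : quot := exist rep _ (rep_canon w).

Definition quot_adj : rel quot := fun x y => adj H (val x) (val y) || adj H (val x) (io
  (val y)).

Lemma adj_io u v : adj H u (io v) = adj H (io u) v.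
Proof. by rewrite -io_adj ioK. Qed.

Lemma quot_adj_sym : symmetric quot_adj.
Proof.
by move=> x y; rewrite /quot_adj adj_sym; congr (_ || _); rewrite adj_io adj_sym.
Qed.

Lemma quot_adj_irr : irreflexive quot_adj.
Proof. by move=> x; rewrite /quot_adj adj_irr (negbTE (io_loop _)). Qed.

Definition quot_graph : graph quot := Graph quot_adj_sym quot_adj_irr.

(** By [io_simple], exactly one alternative of [quot_adj] holds on an edge, and the sign records
    which. *)
Definition quot_sgn (e : {set quot}) : int :=
  if [exists x in e, exists y in e, adj H (val x) (val y)] then 1 else -1.

Lemma quot_sgn_val e : quot_sgn e = 1 \/ quot_sgn e = -1.
Proof. by rewrite /quot_sgn; case: ifP; [left | right]. Qed.

Definition quotient : signed_graph quot :=
  SignedGraph (fun (e : {set quot}) (_ : e \in edges quot_graph) => quot_sgn_val e).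

Lemma quot_sgnE x y : sgn quotient [set x; y] = if adj H (val x) (val y) then 1 else -1.
Proof.
rewrite /= /quot_sgn; congr (if _ then _ else _); apply/idP/idP => [|xy].
  move=> /exists_inP[u + /exists_inP[v]]; rewrite !inE.
  by move=> /orP[] /eqP-> /orP[] /eqP->; rewrite ?adj_irr // adj_sym.
apply/exists_inP; exists x; first by rewrite set21.
by apply/exists_inP; exists y; first by rewrite set22.
Qed.

Definition lift_dc (z : quot * bool) : W := if z.2 then val z.1 else io (val z.1).

Lemma lift_dc_bij : bijective lift_dc.
Proof.
exists (fun w => (proj w, rep w)) => [[x b]|w].
  have rx := valP x; congr (_, _); rewrite /lift_dc /=; case: b => //=.
  - by apply: val_inj => /=; rewrite rx.
  - by apply: val_inj => /=; rewrite rep_io rx /= ioK.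
  - by rewrite rep_io rx.
by rewrite /lift_dc /=; case: (rep w); rewrite ?ioK.
Qed.

Lemma adj_lift_dc x y : adj H (lift_dc x) (lift_dc y) = adj (DC quotient) x y.
Proof.
case: x y => [x b] [y c]; rewrite /= /dc_adj quot_sgnE /lift_dc /= /quot_adj.
have xy : adj H (val x) (val y) -> adj H (val x) (io (val y)) = false.
  by move=> /io_simple /negbTE.
by case: b c => -[]; rewrite /= ?io_adj -?adj_io; move: xy;
  case: (adj H (val x) (val y)) => xy; rewrite ?(xy isT) /= ?andbT ?andbF.
Qed.

Lemma quotient_iso : graph_iso (DC quotient) H.
Proof. by exists lift_dc; [exact: lift_dc_bij | exact: adj_lift_dc]. Qed.

Lemma card_quotient : #|W| = (2 * #|quot|)%N.
Proof. by rewrite -(bij_eq_card lift_dc_bij) card_prod card_bool mulnC. Qed.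

(** An edge of the quotient has two lifts, each counted in both orientations: hence the 4. *)
Lemma sum_adj_quotient :
  (\sum_u \sum_v adj H u v = 4 * #|edges quotient|)%N.
Proof.
have [g fK gK] := lift_dc_bij.
have re F : (\sum_u F u = \sum_x \sum_b F (lift_dc (x, b)))%N.
  rewrite pair_big /= (reindex lift_dc) /=; last by exists g => ? _.
  by apply: eq_bigr => -[].
rewrite re (eq_bigr (fun x => \sum_y 2 * adj quotient x y)%N); last first.
  move=> x _; under eq_bigr do rewrite re; rewrite exchange_big /=.
  apply: eq_bigr => y _; rewrite !big_bool /= !adj_lift_dc /= /dc_adj /=.
  by case: (quot_adj x y) (quot_sgn_val [set x; y]) => // -[] ->.
under eq_bigr do rewrite -big_distrr; rewrite -big_distrr /= (sum_adj_edges quotient).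
by rewrite mulnA.
Qed.

(** The sheet written as a sign, so that lifting a path multiplies it by the sign of the path. *)
Definition side w : int := if rep w then 1 else -1.

Lemma proj_val x : proj (val x) = x.
Proof. by apply: val_inj => /=; rewrite (valP x). Qed.

Lemma proj_io w : proj (io w) = proj w.
Proof. by apply: val_inj => /=; rewrite rep_io; case: (rep w) => //=; rewrite ioK. Qed.

Lemma side_inj u v : proj u = proj v -> side u = side v -> u = v.
Proof.
move=> /(congr1 val) /=; rewrite /side; case: (rep u); case: (rep v) => //.
by move=> e _; apply: (can_inj ioK).
Qed.

Lemma lift_edge w y : adj quotient (proj w) y ->
  exists w', [/\ proj w' = y, adj H w w' & side w' = side w * sgn quotient [set proj w;
    y]].
Proof.
rewrite quot_sgnE /= /quot_adj /side /=; have ry := valP y.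
case: (boolP (rep w)) => rw; case: (boolP (adj H _ (val y))) => /= a1 a2.
- by exists (val y); rewrite proj_val ry.
- by exists (io (val y)); rewrite proj_io proj_val rep_io ry.
- exists (io (val y)); rewrite proj_io proj_val rep_io ry; split=> //.
  by rewrite adj_io.
- exists (val y); rewrite proj_val ry; split=> //.
  by rewrite -io_adj.
Qed.

Fixpoint path_sign (x : quot) p : int :=
  if p is y :: p' then sgn quotient [set x; y] * path_sign y p' else 1.

Lemma lift_path w p : path (adj quotient) (proj w) p ->
  exists ws, [/\ map proj ws = p, path (adj H) w ws &
    side (last w ws) = side w * path_sign (proj w) p].
Proof.
elim: p w => [|y p IH] w; first by exists [::]; rewrite mulr1.
move=> /= /andP[/lift_edge[w' [wy ww' sw']]]; rewrite -wy => /IH[ws [<- h1 h2]].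
by exists (w' :: ws); rewrite /= ww' h1 h2 sw' wy mulrA.
Qed.

Lemma cycle_sign_path x p : uniq (x :: p) ->
  cycle_sign quotient (x :: p) = path_sign x (rcons p x).
Proof.
move=> u; rewrite /cycle_sign.
have -> : path_sign x (rcons p x) =
    \prod_(z <- zip (x :: p) (rcons p x)) sgn quotient [set z.1; z.2].
  move: {2 4}x => y; elim: p x {u} => [|a p IH] x /=; first by rewrite big_seq1 mulr1.
  by rewrite big_cons IH.
have -> : zip (x :: p) (rcons p x) = [seq (y, next (x :: p) y) | y <- x :: p].
  apply: (@eq_from_nth _ (x, x)).
    by rewrite size_zip size_map size_rcons minnn.
  move=> i; rewrite size_zip size_rcons minnn => hi.
  rewrite nth_zip ?size_rcons // (nth_map x) //; congr (_, _).
  rewrite next_nth mem_nth // index_uniq // nth_rcons.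
  move: hi; rewrite ltnS leq_eqVlt => /orP[/eqP->|->//].
  by rewrite ltnn eqxx nth_default.
by rewrite big_map.
Qed.

(** Sign 1 means that the lifted path ends on the sheet where it started, hence at its starting
    vertex. *)
Lemma lift_positive_cycle r : contains_C 1 r quotient ->
  exists ws, [/\ size ws = r, cycle (adj H) ws & uniq (map proj ws)].
Proof.
move=> [[|x p] [[//]]] _ /andP[cyc un] sz; rewrite cycle_sign_path // => sg.
have [ws [wsp pa sw]] : exists ws, [/\ map proj ws = rcons p x, path (adj H) (val x) ws
  &
    side (last (val x) ws) = side (val x) * 1].
  by have := @lift_path (val x) (rcons p x); rewrite proj_val sg; apply.
case/lastP: ws wsp pa sw => [/(congr1 size)|ws w]; first by rewrite size_rcons.
rewrite map_rcons => /rcons_inj[wsp wx] pa; rewrite last_rcons mulr1 => sw.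
have wE : w = val x by apply: side_inj; rewrite ?proj_val.
exists (val x :: ws); split; first by rewrite -sz /= -wsp size_map.
  by rewrite /= -wE in pa *.
by rewrite /= proj_val wsp.
Qed.

(** The 2-colouring is invariant under [io] and descends to the quotient, which then has no odd
    closed walk. *)
Lemma quotient_no_C5 (col : W -> bool) s :
  (forall w, col (io w) = col w) -> (forall u v, adj H u v -> col u = ~~ col v) ->
  ~ contains_C s 5 quotient.
Proof.
move=> col_io col_adj [c [[_ /andP[cyc _]] sz _]].
have colq x y : quot_adj x y -> col (val x) = ~~ col (val y).
  by move=> /orP[] /col_adj -> //; rewrite col_io.
case: c sz cyc => [|a [|b [|c [|d [|e [|? ?]]]]]] //= _.
move=> /and5P[/colq h1 /colq h2 /colq h3 /colq h4 /andP[/colq h5 _]].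
by move: h1; rewrite h2 h3 h4 h5; case: (col _).
Qed.

End FreeInvolution.

(** * The quotient of B_5(q)[4] *)

Lemma sum_sig_notin (T : finType) (A : {set T}) (F : T -> nat) :
  (\sum_(x : {x | x \notin A}) F (val x) = \sum_(x | x \notin A) F x)%N.
Proof. exact: esym (big_sub _ _). Qed.

Lemma sum_adj_bipartite (P L : finType) (I : P -> L -> bool) :
  (\sum_u \sum_v adj (bipartite I) u v = 2 * \sum_l \sum_p I p l)%N.
Proof.
rewrite big_sumType /= mul2n -addnn; congr (_ + _)%N.
  rewrite exchange_big /=; rewrite [LHS]big_sumType /= big1 ?add0n //.
  by move=> p _; rewrite big1.
apply: eq_bigr => l _; rewrite big_sumType /= [X in (_ + X)%N]big1 ?addn0 //.
Qed.

Lemma sum_clone (P L : finType) (I : P -> L -> bool) k l :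
  (\sum_z clone I (k := k) z l = k * \sum_p I p l)%N.
Proof.
rewrite big_distrr /= -(pair_bigA _ (fun p (i : 'I_k) => I p l : nat)) /=.
by apply: eq_bigr => p _; rewrite sum_nat_const card_ord.
Qed.

Lemma clone4_no_decagon (P L : finType) (I : P -> L -> bool)
    (ws : seq (P * 'I_4 + L)) :
  (forall p1 p2 p3 p4 p5 l1 l2 l3 l4 l5,
     I p1 l1 -> I p1 l2 -> I p2 l2 -> I p2 l3 -> I p3 l3 -> I p3 l4 ->
     I p4 l4 -> I p4 l5 -> I p5 l5 -> I p5 l1 -> uniq [:: l1; l2; l3; l4; l5] ->
     [/\ p1 = p2, p2 = p3, p3 = p4 & p4 = p5]) ->
  size ws = 10 -> cycle (adj (bipartite (clone I (k := 4)))) ws -> ~~ uniq ws.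
Proof.
move=> pentagon sz cyc; apply/negP => un; set H := bipartite _ in cyc.
suff key ws' : size ws' = 10 -> cycle (adj H) ws' -> uniq ws' ->
    (if ws' is inr _ :: _ then True else False) -> False.
  case: ws sz cyc un => [//|[p|l] ws] sz cyc un; last exact: key sz cyc un Logic.I.
  apply: (key (rot 1 (inl p :: ws))); rewrite ?size_rot ?rot_cycle ?rot_uniq //.
  by case: ws sz cyc {un} => [//|[p'|l] ws].
move=> {ws sz cyc un} sz cyc un.
case: ws' sz cyc un => [|w1 [|w2 [|w3 [|w4 [|w5 [|w6 [|w7 [|w8 [|w9 [|w10 [|?
  ?]]]]]]]]]]] // _.
case: w1 => [//|l1]; case: w2 => [[p1 i1]|l]; last by [].
case: w3 => [[? ?]|l2]; first by rewrite /= andbF.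
case: w4 => [[p2 i2]|l]; last by rewrite /= !andbF.
case: w5 => [[? ?]|l3]; first by rewrite /= !andbF.
case: w6 => [[p3 i3]|l]; last by rewrite /= !andbF.
case: w7 => [[? ?]|l4]; first by rewrite /= !andbF.
case: w8 => [[p4 i4]|l]; last by rewrite /= !andbF.
case: w9 => [[? ?]|l5]; first by rewrite /= !andbF.
case: w10 => [[p5 i5]|l]; last by rewrite /= !andbF.
move=> cyc un _; move: cyc; rewrite /= /clone /= andbT.
move=> /and5P[a1 a2 a3 a4 /and5P[a5 a6 a7 a8 /andP[a9 a10]]].
(* Lines carry no clone index, so distinct line vertices are distinct elements of [L]. *)
have ul : uniq [:: l1; l2; l3; l4; l5].
  rewrite -(map_inj_uniq (@inr_inj (P * 'I_4) L)).
  exact: subseq_uniq (mask_subseq (flatten (nseq 5 [:: true; false])) _) un.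
have [e1 e2 e3 e4] := pentagon _ _ _ _ _ _ _ _ _ _ a1 a2 a3 a4 a5 a6 a7 a8 a9 a10 ul.
subst p2 p3 p4 p5; have ui : uniq [:: i1; i2; i3; i4; i5].
  apply: (@map_uniq _ _ (fun i => inl (p1, i) : P * 'I_4 + L)).
  exact: subseq_uniq (mask_subseq (flatten (nseq 5 [:: false; true])) _) un.
by have := max_card [in [:: i1; i2; i3; i4; i5]]; rewrite (card_uniqP ui) card_ord.
Qed.

Section Quotient5.
Variable q : nat.
Hypothesis q_prime : prime q.
Hypothesis q_odd : odd q.
Implicit Types p l x y : F5 q.

Definition vec5 (a b c d e : 'F_q) : F5 q :=
  \row_(i < 5) [:: a; b; c; d; e]`_i.

Lemma coord5_vec5 a b c d e :
  [/\ coord5 (vec5 a b c d e) 1 = a, coord5 (vec5 a b c d e) 2 = b,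
    coord5 (vec5 a b c d e) 3 = c, coord5 (vec5 a b c d e) 4 = d &
    coord5 (vec5 a b c d e) 5 = e].
Proof. by rewrite /coord5 !mxE !inordK. Qed.

Lemma vec5K x : vec5 (coord5 x 1) (coord5 x 2) (coord5 x 3) (coord5 x 4) (coord5 x 5) =
  x.
Proof. by have [? ? ? ? ?] := coord5_vec5 (coord5 x 1) (coord5 x 2) (coord5 x 3)
  (coord5 x 4) (coord5 x 5); exact: coord5_inj. Qed.

Definition flip_point p : F5 q :=
  vec5 (- coord5 p 1) (- coord5 p 2) (coord5 p 3) (- coord5 p 4) (- coord5 p 5).

Definition flip_line l : F5 q :=
  vec5 (coord5 l 1) (- coord5 l 2) (coord5 l 3) (- coord5 l 4) (- coord5 l 5).

Lemma coord5_flip_point p :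
  [/\ coord5 (flip_point p) 1 = - coord5 p 1, coord5 (flip_point p) 2 = - coord5 p 2,
    coord5 (flip_point p) 3 = coord5 p 3, coord5 (flip_point p) 4 = - coord5 p 4 &
    coord5 (flip_point p) 5 = - coord5 p 5].
Proof. exact: coord5_vec5. Qed.

Lemma coord5_flip_line l :
  [/\ coord5 (flip_line l) 1 = coord5 l 1, coord5 (flip_line l) 2 = - coord5 l 2,
    coord5 (flip_line l) 3 = coord5 l 3, coord5 (flip_line l) 4 = - coord5 l 4 &
    coord5 (flip_line l) 5 = - coord5 l 5].
Proof. exact: coord5_vec5. Qed.

Lemma flip_pointK : involutive flip_point.
Proof.
move=> p; have [h1 h2 h3 h4 h5] := coord5_flip_point p.
by rewrite {1}/flip_point h1 h2 h3 h4 h5 !opprK vec5K.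
Qed.

Lemma flip_lineK : involutive flip_line.
Proof.
move=> l; have [h1 h2 h3 h4 h5] := coord5_flip_line l.
by rewrite {1}/flip_line h1 h2 h3 h4 h5 !opprK vec5K.
Qed.

Lemma Gamma5_flip p l : Gamma5 (flip_point p) (flip_line l) = Gamma5 p l.
Proof.
have [h1 h2 h3 h4 h5] := coord5_flip_point p.
have [g1 g2 g3 g4 g5] := coord5_flip_line l.
rewrite /Gamma5 h1 h2 h3 h4 h5 g1 g2 g3 g4 g5.
congr [&& _, _, _ & _].
- by rewrite -opprD mulNr eqr_opp.
- by rewrite mulrNN.
- by rewrite -opprD mulNr eqr_opp.
have -> (a b c d : 'F_q) : - a * b - c * - d = - (a * b - c * d) by ring.
by rewrite -opprD eqr_opp.
Qed.

Lemma oppr_eq (a : 'F_q) : - a = a -> a = 0.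
Proof.
move=> /eqP; rewrite eq_sym -subr_eq0 opprK -mulr2n -mulr_natl mulf_eq0.
by rewrite (negbTE (two_neq0_Fp q_prime q_odd)) => /eqP.
Qed.

Lemma flip_point_P0 p : (flip_point p \in P0 q) = (p \in P0 q).
Proof.
by have [h1 h2 h3 h4 h5] := coord5_flip_point p; rewrite !inE h1 h2 h4 h5 !oppr_eq0.
Qed.

Lemma flip_line_L0 l : (flip_line l \in L0 q) = (l \in L0 q).
Proof.
by have [h1 h2 h3 h4 h5] := coord5_flip_line l; rewrite !inE h2 h4 h5 !oppr_eq0.
Qed.

Lemma flip_point_fix p : flip_point p = p -> p \in P0 q.
Proof.
have [h1 h2 _ h4 h5] := coord5_flip_point p => e; rewrite e in h1 h2 h4 h5.
by rewrite inE (oppr_eq (esym h1)) (oppr_eq (esym h2)) (oppr_eq (esym h4)) (oppr_eq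
  (esym h5)) !eqxx.
Qed.

Lemma flip_line_fix l : flip_line l = l -> l \in L0 q.
Proof.
have [_ h2 _ h4 h5] := coord5_flip_line l => e; rewrite e in h2 h4 h5.
by rewrite inE (oppr_eq (esym h2)) (oppr_eq (esym h4)) (oppr_eq (esym h5)) !eqxx.
Qed.

Local Notation PT := {p : F5 q | p \notin P0 q}.
Local Notation LT := {l : F5 q | l \notin L0 q}.
Local Notation W := (PT * 'I_4 + LT)%type.

Lemma flip_point_notin (p : PT) : flip_point (val p) \notin P0 q.
Proof. by rewrite flip_point_P0 (valP p). Qed.

Lemma flip_line_notin (l : LT) : flip_line (val l) \notin L0 q.
Proof. by rewrite flip_line_L0 (valP l). Qed.

Definition flip (w : W) : W :=
  match w with
  | inl (p, i) => inl (exist _ (flip_point (val p)) (flip_point_notin p), i)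
  | inr l => inr (exist _ (flip_line (val l)) (flip_line_notin l))
  end.

Local Notation H := (B5_clone4 q).

Lemma flipK : involutive flip.
Proof.
move=> [[p i]|l] /=.
  by congr (inl (_, _)); apply: val_inj; rewrite /= flip_pointK.
by congr inr; apply: val_inj; rewrite /= flip_lineK.
Qed.

Lemma flip_free w : flip w != w.
Proof.
apply/eqP; case: w => [[p i]|l] [] /(congr1 val) /=.
  by move=> /flip_point_fix; apply/negP; exact: (valP p).
by move=> /flip_line_fix; apply/negP; exact: (valP l).
Qed.

Lemma flip_adj u v : adj H (flip u) (flip v) = adj H u v.
Proof.
by case: u v => [[p i]|l] [[p' i']|l'] //=; rewrite /clone /B5 /delete /= Gamma5_flip.
Qed.

Lemma flip_loop w : ~~ adj H w (flip w).
Proof. by case: w => [[p i]|l]. Qed.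

(** [flip_line] keeps the first coordinate, which determines a line through a given point. Deleting
    [L0] therefore makes the quotient simple. *)
Lemma Gamma5_flip_line p l : Gamma5 p l -> Gamma5 p (flip_line l) -> l \in L0 q.
Proof.
move=> h h'; apply: flip_line_fix; apply: (Gamma5_line_inj h' h).
by have [] := coord5_flip_line l.
Qed.

Lemma flip_simple u v : adj H u v -> ~~ adj H u (flip v).
Proof.
case: u v => [[p i]|l] [[p' i']|l'] //=; rewrite /clone /B5 /delete /= => h.
  by apply: contra (valP l') => /(Gamma5_flip_line h).
apply: contra (valP l); rewrite -Gamma5_flip flip_pointK.
exact: Gamma5_flip_line.
Qed.

Definition Q5 := quotient flipK flip_adj flip_loop.

Lemma Q5_no_C10 : ~ contains_C 1 10 Q5.
Proof.
move=> /(lift_positive_cycle flip_free)[ws [sz cyc /map_uniq]].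
apply/negP; apply: clone4_no_decagon sz cyc => p1 p2 p3 p4 p5 l1 l2 l3 l4 l5.
move=> a1 a2 a3 a4 a5 a6 a7 a8 a9 a10; rewrite -(map_inj_uniq val_inj) => ul.
have [e1 e2 e3 e4] := Gamma5_pentagon q_prime q_odd a1 a2 a3 a4 a5 a6 a7 a8 a9 a10 ul.
by split; apply: val_inj.
Qed.

Lemma Q5_no_C5 : ~ contains_C (-1) 5 Q5.
Proof.
apply: (@quotient_no_C5 _ H _ _ _ _ (fun w => if w is inl _ then true else false)).
  by move=> [[]|].
by move=> [[p i]|l] [[p' i']|l'].
Qed.

Lemma Q5_iso : graph_iso (DC Q5) H.
Proof. exact: quotient_iso _ flip_free _ _ flip_simple. Qed.

Lemma card_F5 : #|F5 q| = (q ^ 5)%N.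
Proof. by rewrite card_mx card_Fp. Qed.

Lemma card_P0 : #|P0 q| = q.
Proof.
rewrite -[RHS](card_Fp q_prime) -cardsT -(card_imset _ (f := fun a => vec5 0 0 a 0 0));
  last first.
  move=> a b /(congr1 (fun x => coord5 x 3)).
  by have [_ _ -> _ _] := coord5_vec5 0 0 a 0 0;
    have [_ _ -> _ _] := coord5_vec5 0 0 b 0 0.
apply: eq_card => x; rewrite inE; apply/idP/imsetP => [/and4P[/eqP h1 /eqP h2 /eqP h4
  /eqP h5]|[a _ ->]].
  by exists (coord5 x 3) => //; rewrite -[LHS]vec5K h1 h2 h4 h5.
by have [-> -> _ -> ->] := coord5_vec5 0 0 a 0 0; rewrite eqxx.
Qed.

Lemma card_L0 : #|L0 q| = (q ^ 2)%N.
Proof.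
transitivity #|[set: 'F_q * 'F_q]|; last by rewrite cardsT card_prod !card_Fp // mulnn.
rewrite -(card_imset _ (f := fun a => vec5 a.1 0 a.2 0 0)); last first.
  move=> [a b] [c d] /= e; have := congr1 (fun x => coord5 x 3) e;
    have := congr1 (fun x => coord5 x 1) e.
  have [-> _ -> _ _] := coord5_vec5 a 0 b 0 0.
  by have [-> _ -> _ _] := coord5_vec5 c 0 d 0 0 => -> ->.
apply: eq_card => x; rewrite inE; apply/idP/imsetP => [/and3P[/eqP h2 /eqP h4 /eqP
  h5]|[a _ ->]].
  by exists (coord5 x 1, coord5 x 3); rewrite ?inE //= -[LHS]vec5K h2 h4 h5.
by have [_ -> _ -> ->] := coord5_vec5 a.1 0 a.2 0 0; rewrite eqxx.
Qed.

Lemma card_notin (A : {set F5 q}) : #|{: {x | x \notin A}}| = (q ^ 5 - #|A|)%N.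
Proof. by rewrite card_sig -card_F5 -(cardC (mem A)) addKn; apply: eq_card. Qed.

Lemma card_Q5 : (2 * #|quot flip| = 4 * (q ^ 5 - q) + (q ^ 5 - q ^ 2))%N.
Proof.
rewrite -(card_quotient flipK flip_free) card_sum card_prod !card_notin card_ord.
by rewrite card_P0 card_L0 mulnC.
Qed.

Lemma card_Gamma5_points l : (\sum_p Gamma5 p l = q)%N.
Proof.
rewrite (eq_bigr (fun p => if Gamma5 p l then 1 else 0)%N); last by move=> p _;
  case: Gamma5.
rewrite -big_mkcond /= sum1_card -[RHS](card_Fp q_prime) -cardsT.
rewrite -(card_imset _ (f := fun x : 'F_q =>
   vec5 x (x * coord5 l 1 - coord5 l 2) (x * coord5 l 2 - coord5 l 3)
     (x * coord5 l 3 - coord5 l 4)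
     ((x * coord5 l 1 - coord5 l 2) * coord5 l 3
        - (x * coord5 l 2 - coord5 l 3) * coord5 l 2 - coord5 l 5))); last first.
  have c1 (x b c d e : 'F_q) : coord5 (vec5 x b c d e) 1 = x by have [] := coord5_vec5
    x b c d e.
  by move=> a b /(congr1 (fun x => coord5 x 1)); rewrite !c1.
apply: eq_card => p; rewrite unfold_in.
apply/Gamma5P/imsetP => [[h2 h3 h4 h5]|[a _ ->]].
  by exists (coord5 p 1) => //; rewrite -[LHS]vec5K h5 h4 h3 h2.
by have [-> -> -> -> ->] := coord5_vec5 a (a * coord5 l 1 - coord5 l 2)
  (a * coord5 l 2 - coord5 l 3) (a * coord5 l 3 - coord5 l 4)
  ((a * coord5 l 1 - coord5 l 2) * coord5 l 3
     - (a * coord5 l 2 - coord5 l 3) * coord5 l 2 - coord5 l 5).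
Qed.

(** A line outside [L0] hence loses no point when [P0] is deleted and keeps all its q points, which
    makes the edge count exact. *)
Lemma Gamma5_P0 p l : Gamma5 p l -> p \in P0 q -> l \in L0 q.
Proof.
move=> /Gamma5P[]; rewrite !inE => h2 h3 h4 h5 /and4P[/eqP p1 /eqP p2 /eqP p4 /eqP p5].
move: h2 h3 h4 h5; rewrite p1 p2 p4 p5 !mul0r !sub0r => /eqP.
rewrite eq_sym oppr_eq0 => /eqP -> _ /eqP; rewrite eq_sym oppr_eq0 => -> /eqP.
by rewrite mulr0 oppr0 sub0r eq_sym oppr_eq0 => ->; rewrite eqxx.
Qed.

Lemma edges_Q5 : #|edges Q5| = (2 * (q * (q ^ 5 - q ^ 2)))%N.
Proof.
have flags : (\sum_(l : LT) \sum_(p : PT) Gamma5 (val p) (val l) = q * (q ^ 5 - q ^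
  2))%N.
  transitivity (\sum_(l : LT) q)%N; last first.
    by rewrite sum_nat_const mulnC card_notin card_L0.
  apply: eq_bigr => l _; rewrite (sum_sig_notin (P0 q) (fun p => Gamma5 p (val l))).
  rewrite -[RHS](card_Gamma5_points (val l)) big_mkcond; apply: eq_bigr => p _.
  case: ifP => // /negbFE pP; apply/esym/eqP; rewrite eqb0.
  by apply: contra (valP l) => /Gamma5_P0; exact.
apply/eqP; rewrite -(eqn_pmul2l (isT : 0 < 4)%N).
rewrite -(sum_adj_quotient flipK flip_free flip_adj flip_loop flip_simple).
rewrite sum_adj_bipartite; under eq_bigr do rewrite sum_clone.
by rewrite -big_distrr /= /B5 /delete flags; apply/eqP; ring.
Qed.

End Quotient5.

(** * Padding by isolated vertices *)

Section Padding.
Variables (V : finType) (G : signed_graph V) (k : nat).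
Local Notation VK := (V + 'I_k)%type.

Definition pad_adj : rel VK := fun x y =>
  match x, y with inl a, inl b => adj G a b | _, _ => false end.

Lemma pad_adj_sym : symmetric pad_adj.
Proof. by move=> [a|i] [b|j] //=; rewrite adj_sym. Qed.

Lemma pad_adj_irr : irreflexive pad_adj.
Proof. by move=> [a|i] //=; rewrite adj_irr. Qed.

Definition pad_graph : graph VK := Graph pad_adj_sym pad_adj_irr.

Definition pad_sgn (e : {set VK}) : int := sgn G (inl @^-1: e).

Lemma preim_inl2 (a b : V) : inl @^-1: [set (inl a : VK); inl b] = [set a; b].
Proof. by apply/setP => x; rewrite !inE !(inj_eq (@inl_inj _ _)). Qed.

Lemma pad_sgnP e : e \in edges pad_graph -> pad_sgn e = 1 \/ pad_sgn e = -1.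
Proof.
move=> /imset2P[[a|i] [b|j] _]; rewrite !inE //= => ab ->.
by rewrite /pad_sgn preim_inl2; apply: sgnP; rewrite edgesE.
Qed.

Definition pad : signed_graph VK := SignedGraph pad_sgnP.

Lemma edges_pad : #|edges pad| = #|edges G|.
Proof.
apply/eqP; rewrite -(eqn_pmul2l (isT : 0 < 2)%N) -!sum_adj_edges big_sumType /=.
rewrite [X in (_ + X)%N]big1 ?addn0; last by move=> i _; rewrite big1 // => -[].
apply/eqP; apply: eq_bigr => a _; rewrite big_sumType /=.
by rewrite [X in (_ + X)%N]big1 ?addn0.
Qed.

(** Every vertex of a cycle is adjacent to the next one, so none is a padding vertex. *)
Lemma contains_C_pad s r : contains_C s r pad -> contains_C s r G.
Proof.
move=> [c [[sz /andP[cyc un]] szr sg]].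
have [c' cE] : exists c', c = map inl c'.
  have: {in c, forall z, exists a, z = inl a}.
    by move=> z zc; have := next_cycle cyc zc; case: z zc => [a|i] _; first by exists a.
  elim: c {sz cyc un szr sg} => [|z c IH] h; first by exists [::].
  have [a ->] := h z (mem_head _ _).
  have [|c' ->] := IH; first by move=> u uc; apply: h; rewrite inE uc orbT.
  by exists (a :: c').
move: sz cyc un szr sg; rewrite cE size_map (map_inj_uniq (@inl_inj _ _)) => sz cyc un
  szr sg.
have cyc' : cycle (adj G) c'.
  by case: c' {sz un szr sg cE} cyc => //= x p; rewrite -map_rcons path_map.
exists c'; split=> //; first by split=> //; rewrite /ucycle cyc'.
rewrite -sg /cycle_sign big_map; apply: eq_bigr => x _.
by rewrite (next_map (@inl_inj _ _)) //= /pad_sgn preim_inl2.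
Qed.

End Padding.

Lemma exhat_ge (V : finType) (G : signed_graph V) n s r :
  (#|V| <= n)%N -> ~ contains_C s r G -> (#|edges G| <= exhat n s r)%N.
Proof.
move=> Vn Gfree; rewrite -(edges_pad G (n - #|V|)).
apply: exhat_ub; first by rewrite card_sum card_ord subnKC.
by move=> /contains_C_pad.
Qed.

Lemma exhat_prime_ge q n : prime q -> odd q -> (5 * q ^ 5 <= 2 * n)%N ->
  (2 * (q ^ 6 - q ^ 3) <= exhat n 1 10)%N.
Proof.
move=> pq oq qn; have := edges_Q5 pq oq.
have -> : (q * (q ^ 5 - q ^ 2) = q ^ 6 - q ^ 3)%N by rewrite mulnBr -!expnS.
move=> <-; apply: exhat_ge; last exact: Q5_no_C10.
rewrite -(leq_pmul2l (isT : 0 < 2)%N) card_Q5 //; apply: leq_trans qn; lia.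
Qed.

Lemma Q5_spec q : prime q -> odd q ->
     exists (V : finType) (Q : signed_graph V),
       [/\ graph_iso (DC Q) (B5_clone4 q),
           #|V|%:R = (5 * q%:R ^+ 5 - q%:R ^+ 2 - 4 * q%:R) / 2 :> rat,
           #|edges Q|%:R = 2 * (q%:R ^+ 6 - q%:R ^+ 3) :> rat,
           ~ contains_C (-1) 5 Q &
           ~ contains_C 1 10 Q].
Proof.
move=> pq oq; exists _, (Q5 q); have q0 := prime_gt0 pq.
have le1 : (q <= q ^ 5)%N by rewrite -{1}[q]expn1 leq_pexp2l.
have le2 : (q ^ 2 <= q ^ 5)%N by rewrite leq_pexp2l.
split; [exact: Q5_iso | | | exact: Q5_no_C5 | exact: Q5_no_C10].
  have := congr1 (fun k => k%:R : rat) (card_Q5 pq oq).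
  rewrite natrD !natrM !natrB // !natrX; lra.
by rewrite edges_Q5 // !natrM natrB // !natrX; ring.
Qed.

(** * Moebius and von Mangoldt functions *)

(** Both sides run over the pairs with d k <= N; the right side collects them by the product n = d
    k. *)
Lemma sum_dvd_exchange (V : nmodType) (G : nat -> nat -> V) N :
  \sum_(1 <= d < N.+1) \sum_(1 <= k < (N %/ d).+1) G d k =
  \sum_(1 <= n < N.+1) \sum_(d <- divisors n) G d (n %/ d)%N.
Proof.
transitivity (\sum_(1 <= n < N.+1) \sum_(1 <= d < N.+1 | (d %| n)%N)
    G d (n %/ d)%N); last first.
  apply: eq_big_nat => n /andP[n_gt0 leN]; rewrite -big_filter.
  apply: perm_big; apply: uniq_perm; rewrite ?filter_uniq ?iota_uniq ?divisors_uniq //.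
  move=> d; rewrite mem_filter mem_index_iota -dvdn_divisors // ltnS.
  by case: (boolP (d %| n)%N) => //= dn; rewrite (dvdn_gt0 n_gt0 dn) (leq_trans
    (dvdn_leq n_gt0 dn)).
under [in RHS]eq_bigr do rewrite big_mkcond.
rewrite exchange_big_nat /=; apply: eq_big_nat => d /andP[d_gt0 _].
rewrite -big_mkcond -[RHS]big_filter.
rewrite [RHS](perm_big [seq (d * k)%N | k <- index_iota 1 (N %/ d).+1]); last first.
  apply: uniq_perm.
  - by rewrite filter_uniq ?iota_uniq.
  - rewrite map_inj_in_uniq ?iota_uniq // => a b _ _ /eqP.
    by rewrite eqn_pmul2l // => /eqP.
  move=> n; rewrite mem_filter mem_index_iota /=; apply/idP/mapP.
    move=> /andP[/dvdnP[k ->]] /andP[kd]; rewrite ltnS => kN.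
    exists k; rewrite 1?mulnC // mem_index_iota ltnS leq_divRL // kN andbT.
    by move: kd; rewrite muln_gt0 => /andP[].
  move=> [k]; rewrite mem_index_iota ltnS leq_divRL // => /andP[k0 kN] ->.
  by rewrite dvdn_mulr //= muln_gt0 d_gt0 k0 ltnS mulnC.
by rewrite big_map; apply: eq_bigr => k _; rewrite mulKn.
Qed.

Definition mobius (n : nat) : int :=
  if all (fun p => logn p n == 1%N) (primes n) then (-1) ^+ size (primes n)
  else 0.

Lemma mobius1 : mobius 1 = 1. Proof. by []. Qed.

Lemma norm_mobius_le1 n : `|mobius n| <= 1.
Proof. by rewrite /mobius; case: ifP => _; rewrite ?normrX ?normrN ?normr1 ?expr1n
  ?normr0. Qed.

Lemma mobius_prime_mul p e : prime p -> ~~ (p %| e)%N -> (0 < e)%N ->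
  mobius (p * e) = - mobius e.
Proof.
move=> pp pe e0; have p0 := prime_gt0 pp.
have per : perm_eq (primes (p * e)) (p :: primes e).
  apply: uniq_perm; rewrite ?primes_uniq //= ?primes_uniq ?andbT.
    by rewrite mem_primes (negbTE pe) !andbF.
  by move=> q; rewrite primesM // primes_prime // !inE.
rewrite /mobius (perm_all _ per) (perm_size per) /=.
rewrite lognM // logn_prime // eqxx lognE (negbTE pe) !andbF addn0 eqxx /=.
rewrite (@eq_in_all _ _ (fun q => logn q e == 1%N)).
  by case: ifP; rewrite ?exprS ?mulN1r ?oppr0.
move=> q; rewrite mem_primes => /and3P[qp _ qe].
rewrite lognM // logn_prime //; case: (eqVneq q p) => [epq|_ //].
by rewrite epq (negbTE pe) in qe.
Qed.

Lemma mobius_sqr p n : prime p -> (p ^ 2 %| n)%N -> (0 < n)%N -> mobius n = 0.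
Proof.
move=> pp pn n0; rewrite /mobius ifF //; apply/allPn; exists p.
  by rewrite mem_primes pp n0 (dvdn_trans _ pn) // dvdn_exp.
by rewrite pfactor_dvdn // in pn; apply: contraTneq pn => ->.
Qed.

(** Divisors e prime to p are paired with p e, where [mobius] changes sign; those divisible by p^2
    contribute 0. This one pairing serves both f = 1 and f = ln. *)
Lemma sum_mobius_prime (R : pzRingType) (f : nat -> R) p n :
  prime p -> (p %| n)%N -> (0 < n)%N ->
  \sum_(d <- divisors n) (mobius d)%:~R * f d =
  \sum_(e <- divisors n`_p^') (mobius e)%:~R * (f e - f (p * e)%N).
Proof.
move=> pp pn n0.
have memP e : (e \in divisors n`_p^') = (e %| n)%N && ~~ (p %| e)%N.
  rewrite -dvdn_divisors ?part_gt0 //.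
  apply/idP/andP => [en|[en pe]].
    split; first exact: dvdn_trans en (dvdn_part _ _).
    apply/negP => pe.
    have := pnat_dvd (dvdn_trans pe en) (part_pnat p^' n).
    by rewrite pnatE // !inE eqxx.
  have e0 := dvdn_gt0 n0 en.
  have: (e`_p^' %| n`_p^')%N by apply: partn_dvd.
  by rewrite part_pnat_id // p'natE.
rewrite (bigID (fun d => p %| d)%N) /= addrC.
have -> : \sum_(d <- divisors n | ~~ (p %| d)%N) (mobius d)%:~R * f d =
    \sum_(e <- divisors n`_p^') (mobius e)%:~R * f e.
  rewrite -big_filter; apply: perm_big; apply: uniq_perm;
    rewrite ?filter_uniq ?divisors_uniq // => d.
  by rewrite mem_filter memP -dvdn_divisors // andbC.
rewrite [X in _ + X = _](bigID (fun d => p ^ 2 %| d)%N) /= [X in _ + (X + _)]big1_seq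
  ?add0r; last first.
  move=> d /andP[/andP[_ ppd]]; rewrite -dvdn_divisors // => dn.
  by rewrite (mobius_sqr pp ppd) ?mul0r // (dvdn_gt0 n0).
have -> : \sum_(d <- divisors n | (p %| d)%N && ~~ (p ^ 2 %| d)%N)
     (mobius d)%:~R * f d =
    \sum_(e <- divisors n`_p^') (mobius (p * e))%:~R * f (p * e)%N.
  rewrite -big_filter -[RHS](big_map (muln p) xpredT (fun d => (mobius d)%:~R * f d)).
  apply: perm_big; apply: uniq_perm.
  - by rewrite filter_uniq ?divisors_uniq.
  - rewrite map_inj_in_uniq ?divisors_uniq // => a b _ _ /eqP.
    by rewrite eqn_pmul2l ?prime_gt0 // => /eqP.
  move=> d; rewrite mem_filter -dvdn_divisors //; apply/idP/mapP.
    move=> /andP[/andP[/dvdnP[e ->]]].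
    rewrite expnS expn1 dvdn_pmul2r ?prime_gt0 // => pe epn.
    exists e; last by rewrite mulnC.
    by rewrite memP pe (dvdn_trans (dvdn_mulr p (dvdnn e)) epn).
  move=> [e]; rewrite memP => /andP[en pe] ->.
  rewrite dvdn_mulr //= expnS expn1 dvdn_pmul2l ?prime_gt0 // pe /=.
  by rewrite Gauss_dvd ?pn ?en // prime_coprime.
rewrite -big_split /=; apply: eq_big_seq => e; rewrite memP => /andP[en pe].
by rewrite mobius_prime_mul ?(dvdn_gt0 n0) // rmorphN /= mulrBr mulNr.
Qed.

Lemma sum_mobius (R : pzRingType) n : (0 < n)%N ->
  \sum_(d <- divisors n) (mobius d)%:~R = (n == 1%N)%:R :> R.
Proof.
move=> n0; case: eqVneq => [->|n1]; first by rewrite big_seq1 mobius1.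
under eq_bigr do rewrite -[_%:~R]mulr1.
rewrite (@sum_mobius_prime _ (fun=> 1) (pdiv n)) ?pdiv_dvd ?pdiv_prime //;
  last by rewrite ltn_neqAle eq_sym n1.
by rewrite big1 // => e _; rewrite subrr mulr0.
Qed.

Section Mangoldt.
Variable R : realType.

Definition mangoldt (n : nat) : R :=
  if (1 < n)%N && (pdiv n).-nat n then ln (pdiv n)%:R else 0.

Lemma mangoldt_ge0 n : 0 <= mangoldt n.
Proof. by rewrite /mangoldt; case: ifP => // _; rewrite ln_ge0 // ler1n pdiv_gt0. Qed.

Lemma mangoldt1 : mangoldt 1 = 0. Proof. by []. Qed.

Lemma mangoldt_neq0 n : mangoldt n != 0 -> exists p k, [/\ prime p, (0 < k)%N, n = (p ^
  k)%N & mangoldt n = ln p%:R].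
Proof.
rewrite /mangoldt; case: ifP => [/andP[n1 np] _|]; last by rewrite eqxx.
have pp := pdiv_prime n1.
exists (pdiv n), (logn (pdiv n) n); split=> //.
  by rewrite logn_gt0 pi_pdiv.
by rewrite -p_part part_pnat_id.
Qed.

Lemma mangoldt_pfactor p k : prime p -> (0 < k)%N -> mangoldt (p ^ k) = ln p%:R.
Proof.
move=> pp k0; have p1 := prime_gt1 pp; rewrite /mangoldt.
have -> : pdiv (p ^ k) = p by rewrite -(prednK k0) pdiv_pfactor.
by rewrite -{1}(expn0 p) ltn_exp2l // k0 /= pnatX pnat_id.
Qed.

(** For p = [pdiv n] the pairing leaves - ln p times the sum of [mobius] over the divisors of the
    p'-part, which is 1 if n is a power of p and 0 otherwise. *)
Lemma sum_mobius_ln n : (0 < n)%N ->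
  \sum_(d <- divisors n) (mobius d)%:~R * ln d%:R = - mangoldt n.
Proof.
move=> n0; have [->|n1] := eqVneq n 1%N.
  by rewrite big_seq1 ln1 mulr0 mangoldt1 oppr0.
have lt1n : (1 < n)%N by rewrite ltn_neqAle eq_sym n1.
have pp := pdiv_prime lt1n.
rewrite (@sum_mobius_prime _ (fun d => ln d%:R) (pdiv n)) ?pdiv_dvd //.
rewrite (_ : \sum_(e <- _) _ = - (\sum_(e <- divisors n`_(pdiv n)^') (mobius e)%:~R) *
  ln (pdiv n)%:R).
  rewrite sum_mobius ?part_gt0 // /mangoldt lt1n /= partn_eq1 // pnatNK.
  by case: ifP; rewrite mulNr ?mul1r ?mul0r.
rewrite mulNr mulr_suml -sumrN; apply: eq_big_seq => e.
rewrite -dvdn_divisors ?part_gt0 // => /(dvdn_gt0 (part_gt0 _ _)) e0.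
rewrite natrM lnM ?posrE ?ltr0n ?pdiv_gt0 // opprD [X in _ * X]addrCA subrr addr0.
by rewrite mulrN.
Qed.

(** Induction on n = m p: a divisor of n that does not divide m contains the full power of p in n,
    and the only prime power among these is that power itself, contributing ln p. *)
Lemma sum_mangoldt n : (0 < n)%N -> \sum_(d <- divisors n) mangoldt d = ln n%:R.
Proof.
elim/ltn_ind: n => n IH n0; have [->|n1] := eqVneq n 1%N.
  by rewrite big_seq1 ln1 mangoldt1.
have lt1n : (1 < n)%N by rewrite ltn_neqAle eq_sym n1.
have [p [pp pn]] : exists p, prime p /\ (p %| n)%N.
  by exists (pdiv n); rewrite pdiv_prime ?pdiv_dvd.
have [m nE] : exists m, n = (m * p)%N by apply/dvdnP.
have m0 : (0 < m)%N by move: n0; rewrite nE muln_gt0 => /andP[].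
have mn : (m < n)%N by rewrite nE ltn_Pmulr ?prime_gt1.
rewrite (bigID (fun d => d %| m)%N) /=.
have -> : \sum_(d <- divisors n | (d %| m)%N) mangoldt d = ln m%:R.
  rewrite -IH // -big_filter; apply: perm_big; apply: uniq_perm;
    rewrite ?filter_uniq ?divisors_uniq // => d.
  rewrite mem_filter -!dvdn_divisors //; case: (boolP (d %| m)%N) => //= dm.
  by rewrite nE dvdn_mulr.
have ndvd d : (d %| n)%N -> ~~ (d %| m)%N -> logn p d = logn p n.
  move=> /dvdnP[c ncd] dm.
  have c0 : (0 < c)%N by move: n0; rewrite ncd muln_gt0 => /andP[].
  have d0 : (0 < d)%N by move: n0; rewrite ncd muln_gt0 => /andP[].
  rewrite ncd lognM // (_ : logn p c = 0%N) // lognE pp c0 /=.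
  case: ifP => // /dvdnP[c' cE]; case/negP: dm.
  have /eqP: (m * p = c' * d * p)%N by rewrite -nE ncd cE; ring.
  by rewrite eqn_pmul2r ?prime_gt0 // => /eqP ->; rewrite dvdn_mull.
have ln0 : (0 < logn p n)%N by rewrite logn_gt0 mem_primes pp n0.
rewrite big_mkcond (bigD1_seq (p ^ logn p n)%N) ?divisors_uniq //=; last first.
  by rewrite -dvdn_divisors // pfactor_dvdnn.
rewrite ifT; last first.
  have lpp : logn p p = 1%N := pfactorK 1 pp.
  rewrite pfactor_dvdn // -ltnNge nE (lognM _ m0 (prime_gt0 pp)) lpp.
  by rewrite addn1.
rewrite mangoldt_pfactor // big1_seq ?addr0; last first.
  move=> d /andP[dp]; rewrite -dvdn_divisors // => dn; case: ifP => // dm.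
  apply/eqP; apply: contraNT dp => /mangoldt_neq0[r [k [rp k0 dE _]]].
  have := ndvd _ dn dm; rewrite dE lognX logn_prime //.
  case: eqVneq => [->|_]; first by rewrite muln1 => ->.
  by rewrite muln0 => e0; rewrite -e0 in ln0.
by rewrite nE natrM lnM // posrE ltr0n // prime_gt0.
Qed.

End Mangoldt.

Local Open Scope classical_set_scope.
Local Open Scope ring_scope.

(** * Selberg's formula *)

Section Estimates.
Variable R : realType.
Implicit Types (x y : R) (n : nat).

Lemma ln_leB1 x : 0 < x -> ln x <= x - 1.
Proof.
move=> x0; have := @le_ln1Dx R (x - 1); rewrite addrCA subrr addr0; apply.
by rewrite ltrBrDl addrN.
Qed.

Lemma lnB_le x y : 0 < x -> 0 < y -> ln y - ln x <= (y - x) / x.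
Proof.
move=> x0 y0; rewrite -ln_div ?posrE //.
by rewrite (le_trans (ln_leB1 (divr_gt0 y0 x0))) // mulrBl divff ?gt_eqF.
Qed.

Lemma lnB_ge x y : 0 < x -> 0 < y -> (y - x) / y <= ln y - ln x.
Proof.
by move=> x0 y0; rewrite -lerN2 opprB -mulNr opprB lnB_le.
Qed.

(** The intervals of centre a n and radius e n are nested; l is the supremum of their left ends, so
    the error bound is explicit. *)
Lemma squeeze_increments (a e : nat -> R) :
  (forall n, (0 < n)%N -> 0 <= e n) ->
  (forall n, (0 < n)%N -> `|a n.+1 - a n| <= e n - e n.+1) ->
  exists l, forall n, (0 < n)%N -> `|a n - l| <= e n.
Proof.
move=> e0 H.
have dn m n : (0 < m)%N -> (m <= n)%N -> a n + e n <= a m + e m.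
  move=> m0; elim: n => [|n IH]; first by case: m m0.
  rewrite leq_eqVlt => /orP[/eqP <- //|]; rewrite ltnS => mn.
  have := H n (leq_trans m0 mn); have := IH mn; rewrite ler_norml => ? /andP[]; lra.
have up m n : (0 < m)%N -> (m <= n)%N -> a m - e m <= a n - e n.
  move=> m0; elim: n => [|n IH]; first by case: m m0.
  rewrite leq_eqVlt => /orP[/eqP <- //|]; rewrite ltnS => mn.
  have := H n (leq_trans m0 mn); have := IH mn; rewrite ler_norml => ? /andP[]; lra.
have nested m n : (0 < m)%N -> (0 < n)%N -> a m - e m <= a n + e n.
  move=> m0 n0; have k0 : (0 < maxn m n)%N by rewrite leq_max m0.
  have := up _ _ m0 (leq_maxl m n); have := dn _ _ n0 (leq_maxr m n).
  by have := e0 _ k0; lra.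
pose E : set R := [set z | exists2 n, (0 < n)%N & z = a n - e n].
have ubE n : (0 < n)%N -> ubound E (a n + e n).
  by move=> n0 _ [m m0 ->]; exact: nested.
exists (sup E) => n n0.
have le1 : sup E <= a n + e n.
  by apply: ge_sup; [exists (a 1 - e 1), 1%N | exact: ubE].
have le2 : a n - e n <= sup E.
  by apply: ub_le_sup; [exists (a 1 + e 1); exact: ubE | exists n].
by rewrite ler_norml; lra.
Qed.

Lemma truncn_divn x d : 0 <= x -> (0 < d)%N ->
  Num.truncn (x / d%:R) = (Num.truncn x %/ d)%N.
Proof.
move=> x0 d0; apply/eqP; rewrite truncn_eq ?divr_ge0 //.
have d0' : 0 < d%:R :> R by rewrite ltr0n.
rewrite ler_pdivlMr // ltr_pdivrMr // -!natrM -truncn_ge_nat //.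
by rewrite -truncn_lt_nat // leq_divM ltn_ceil.
Qed.


Lemma truncnN_gt0 x : 1 <= x -> (0 < Num.truncn x)%N.
Proof. by rewrite truncn_gt0. Qed.

Lemma ln_truncn x : 1 <= x ->
  0 <= ln x - ln (Num.truncn x)%:R <= 2 / x /\ (Num.truncn x)%:R^-1 <= 2 / x.
Proof.
move=> x1; have x0 : 0 < x by lra.
have n1 := truncnN_gt0 x1; set n := Num.truncn x in n1 *.
have /andP[nx xn] : n%:R <= x < n%:R + 1 by rewrite natr1; exact: (truncn_itv (ltW x0)).
have n1' : 1 <= n%:R :> R by rewrite ler1n.
have n0 : 0 < n%:R :> R by lra.
have inv : n%:R^-1 <= 2 / x.
  by rewrite ler_pdivlMr // mulrC ler_pdivrMr //; lra.
split=> //; apply/andP; split; first by rewrite subr_ge0 ler_ln ?posrE.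
apply: le_trans inv; apply: le_trans (lnB_le n0 x0) _.
by rewrite ler_pdivrMr // mulVf ?gt_eqF //; lra.
Qed.

Lemma lnS_itv n : (0 < n)%N ->
  (n.+1%:R^-1 <= ln n.+1%:R - ln (n%:R : R)) && (ln n.+1%:R - ln n%:R <= n%:R^-1 :> R).
Proof.
move=> n0; have n0' : 0 < n%:R :> R by rewrite ltr0n.
have n1' : 0 < n.+1%:R :> R by rewrite ltr0n.
have e : n.+1%:R - n%:R = 1 :> R by rewrite -natr1; lra.
have := lnB_le n0' n1'; have := lnB_ge n0' n1'; rewrite e !div1r.
by move=> -> ->.
Qed.

(** The error 4 / x is 2 / x for the sum up to the floor of x and 2 / x for replacing the logarithm
    of the floor by ln x. *)
Lemma harmonic_asymp : exists g, forall x, 1 <= x ->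
  `|\sum_(1 <= k < (Num.truncn x).+1) k%:R^-1 - ln x - g| <= 4 / x.
Proof.
have [|n n0|g H] := @squeeze_increments
    (fun n => \sum_(1 <= k < n.+1) k%:R^-1 - ln n%:R) (fun n => n%:R^-1).
- by move=> n n0; rewrite invr_ge0.
- rewrite big_nat_recr //= ler_norml.
  have /andP[] := lnS_itv n0.
  set u := ln _; set v := ln _; set i := _^-1; set j := _^-1.
  set S := \sum_(1 <= k < _) _. lra.
exists g => x x1; have [/andP[]] := ln_truncn x1.
by have := H _ (truncnN_gt0 x1); rewrite !ler_norml; lra.
Qed.

Lemma sum_ln_div_asymp : exists c, forall x, 1 <= x ->
  `|\sum_(1 <= k < (Num.truncn x).+1) ln k%:R / k%:R - (ln x) ^+ 2 / 2 - c|
     <= 8 * (1 + ln x) / x.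
Proof.
have [|n n0|c H] := @squeeze_increments
    (fun n => \sum_(1 <= k < n.+1) ln k%:R / k%:R - (ln n%:R) ^+ 2 / 2)
    (fun n => (3 + ln n%:R) / n%:R).
- by move=> n n0; rewrite divr_ge0 // addr_ge0 // ln_ge0 // ler1n.
- rewrite big_nat_recr //=.
  have /andP[] := lnS_itv n0.
  have l0 : 0 <= ln n%:R :> R by rewrite ln_ge0 // ler1n.
  have n1 : 1 <= n%:R :> R by rewrite ler1n.
  rewrite -natr1; move: l0 n1; set l := ln n%:R; set L := ln _; set v : R := n%:R.
  move=> l0 n1 h1 h2.
  set S := \sum_(1 <= k < _) _.
  have v0 : 0 < v by lra.
  have v1 : 0 < v + 1 by lra.
  have L0 : 0 <= L by apply: le_trans l0 _; rewrite -subr_ge0; apply: le_trans h1;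
    rewrite invr_ge0 ltW.
  set i := v^-1 in h2 *; set j := (v + 1)^-1 in h1 *.
  have i0 : 0 < i by rewrite invr_gt0.
  have j0 : 0 < j by rewrite invr_gt0.
  have vi : v * i = 1 by rewrite divff ?gt_eqF.
  have vj : (v + 1) * j = 1 by rewrite divff ?gt_eqF.
  have ij : i - j = i * j.
    have : i * ((v + 1) * j) = i by rewrite vj mulr1.
    have : (v * i) * j = j by rewrite vi mul1r.
    lra.
  have i1 : i <= 1.
    have : 0 <= (v - 1) * i by rewrite mulr_ge0 ?subr_ge0 // ltW.
    lra.
  have ji : i <= 2 * j.
    have : 0 <= (1 - i) * j by rewrite mulr_ge0 ?subr_ge0 // ltW.
    lra.
  (* With d = ln (n + 1) - ln n the increment is L (j - d) + d^2 / 2. The facts below are the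
     products of nonnegative factors that linear arithmetic cannot form. *)
  have [d [-> {}h1 {}h2]] : exists d, [/\ l = L - d, j <= d & d <= i].
    by exists (L - l); split=> //; lra.
  have e1 : 0 <= L * (d - j) by rewrite mulr_ge0 ?subr_ge0.
  have e2 : 0 <= L * (i - d) by rewrite mulr_ge0 ?subr_ge0.
  have e3 : 0 <= (i - d) * d by rewrite mulr_ge0 ?subr_ge0 //; lra.
  have e4 : 0 <= (i - d) * i by rewrite mulr_ge0 ?subr_ge0 //; lra.
  have e5 : 0 <= (2 * j - i) * i by rewrite mulr_ge0 ?subr_ge0 //; lra.
  have e6 : 0 <= d * d by rewrite mulr_ge0 //; lra.
  rewrite ler_norml; lra.
exists c => x x1; have [/andP[h1 h2] h3] := ln_truncn x1.
have := H _ (truncnN_gt0 x1); move: h1 h2 h3; set n := Num.truncn x.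
have l0 : 0 <= ln n%:R :> R by rewrite ln_ge0 // ler1n truncnN_gt0.
have x0 : 0 < x by lra.
set l := ln n%:R; set X := ln x; set t := x^-1; set m := n%:R^-1;
  set S := \sum_(1 <= k < _) _.
move: l0; rewrite -/l => l0 h1 h2 h3.
have t0 : 0 < t by rewrite invr_gt0.
have e1 : 0 <= (3 + l) * (2 * t - m) by rewrite mulr_ge0 //; lra.
have e2 : 0 <= (2 * t - (X - l)) * (X + l) by rewrite mulr_ge0 //; lra.
have e3 : 0 <= (X - l) * t by rewrite mulr_ge0 //; lra.
have e4 : 0 <= (X - l) * (X + l) by rewrite mulr_ge0 //; lra.
have e5 : 0 <= X * t by rewrite mulr_ge0 //; lra.
rewrite !ler_norml; lra.
Qed.


End Estimates.

Lemma sum_divisors_rev (V : nmodType) (G : nat -> nat -> V) n : (0 < n)%N ->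
  \sum_(d <- divisors n) G d (n %/ d)%N = \sum_(d <- divisors n) G (n %/ d)%N d.
Proof.
move=> n0; have dvd_inj d : (d %| n)%N -> (n %/ (n %/ d))%N = d.
  by move=> /dvdnP[c nE]; move: n0; rewrite nE muln_gt0 => /andP[c0 d0];
    rewrite mulnK // mulKn.
rewrite [RHS](perm_big [seq (n %/ d)%N | d <- divisors n]) /=; last first.
  apply: uniq_perm; rewrite ?divisors_uniq //.
    rewrite map_inj_in_uniq ?divisors_uniq // => a b.
    by rewrite -!dvdn_divisors // => /dvd_inj {2}<- /dvd_inj {2}<- ->.
  move=> d; rewrite -dvdn_divisors //; apply/idP/mapP => [dn|[e]].
    by exists (n %/ d)%N; rewrite ?dvd_inj // -dvdn_divisors // dvdn_div.
  by rewrite -dvdn_divisors // => en ->; rewrite dvdn_div.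
rewrite big_map; apply: eq_big_seq => d; rewrite -dvdn_divisors // => dn.
by rewrite dvd_inj.
Qed.

Section Selberg.
Variable R : realType.
Implicit Types (x y : R) (n : nat).
Local Notation mangoldt := (mangoldt R).

Definition mertens x : R := \sum_(1 <= n < (Num.truncn x).+1) mangoldt n / n%:R.

(** The choice f = 1 recovers F x; f d = ln (x / d) gives ln x F x plus the [mangoldt] average of F,
    the Tatuzawa-Iseki identity with weights 1 / n. *)
Lemma mobius_transform (f : nat -> R) (F : R -> R) x : 0 <= x ->
  \sum_(1 <= d < (Num.truncn x).+1) (mobius d)%:~R * f d / d%:R *
    \sum_(1 <= k < (Num.truncn (x / d%:R)).+1) F (x / d%:R / k%:R) / k%:R =
  \sum_(1 <= n < (Num.truncn x).+1) F (x / n%:R) / n%:R *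
    \sum_(d <- divisors n) (mobius d)%:~R * f d.
Proof.
move=> x0.
pose G d k := (mobius d)%:~R * f d / d%:R * (F (x / d%:R / k%:R) / k%:R).
transitivity (\sum_(1 <= d < (Num.truncn x).+1)
    \sum_(1 <= k < (Num.truncn x %/ d).+1) G d k).
  apply: eq_big_nat => d /andP[d0 _]; rewrite mulr_sumr truncn_divn //.
rewrite sum_dvd_exchange; apply: eq_big_nat => n /andP[n0 _].
rewrite mulr_sumr; apply: eq_big_seq => d; rewrite -dvdn_divisors // => /dvdnP[c nE].
move: n0; rewrite nE muln_gt0 => /andP[c0 d0]; rewrite mulnK // /G natrM.
have c0' : c%:R != 0 :> R by rewrite pnatr_eq0 -lt0n.
have d0' : d%:R != 0 :> R by rewrite pnatr_eq0 -lt0n.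
have -> : x / d%:R / c%:R = x / (c%:R * d%:R) by field; apply/andP.
by field; apply/andP.
Qed.

Lemma sum_mertens_div x : 0 <= x ->
  \sum_(1 <= k < (Num.truncn x).+1) mertens (x / k%:R) / k%:R =
  \sum_(1 <= n < (Num.truncn x).+1) ln n%:R / n%:R.
Proof.
move=> x0.
transitivity (\sum_(1 <= d < (Num.truncn x).+1)
    \sum_(1 <= k < (Num.truncn x %/ d).+1) mangoldt k / k%:R / d%:R).
  by apply: eq_big_nat => d /andP[d0 _]; rewrite /mertens mulr_suml truncn_divn.
rewrite sum_dvd_exchange; apply: eq_big_nat => n /andP[n0 _].
rewrite (sum_divisors_rev (fun d k => mangoldt k / k%:R / d%:R)) //.
rewrite -sum_mangoldt // mulr_suml; apply: eq_big_seq => d.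
rewrite -dvdn_divisors // => /dvdnP[c nE].
move: n0; rewrite nE muln_gt0 => /andP[c0 d0]; rewrite mulnK // natrM.
by field; rewrite !pnatr_eq0 -!lt0n c0 d0.
Qed.

Lemma sum_inv_sqrt n :
  \sum_(1 <= d < n.+1) (Num.sqrt (d%:R : R))^-1 <= 2 * Num.sqrt n%:R.
Proof.
elim: n => [|n IH]; first by rewrite big_nil mulr_ge0 // sqrtr_ge0.
rewrite big_nat_recr //=.
set a := Num.sqrt n%:R in IH *; set b := Num.sqrt n.+1%:R.
have a0 : 0 <= a by rewrite sqrtr_ge0.
have b0 : 0 < b by rewrite sqrtr_gt0 ltr0n.
have ab : b ^+ 2 - a ^+ 2 = 1 by rewrite !sqr_sqrtr // -natr1; lra.
suff : b^-1 <= 2 * b - 2 * a by move=> h; move: IH; set S := \sum_(1 <= d < _) _; lra.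
rewrite -[b^-1]mul1r ler_pdivrMr //.
have : 0 <= (b - a) ^+ 2 by rewrite sqr_ge0.
lra.
Qed.

Lemma sqr_1ln_le y : 1 <= y -> (1 + ln y) ^+ 2 <= 16 * Num.sqrt y.
Proof.
move=> y1; have y0 : 0 < y by lra.
have l0 := ln_ge0 y1.
pose z := Num.sqrt (Num.sqrt y).
have z0 : 0 < z by rewrite !sqrtr_gt0.
have z2 : z ^+ 2 = Num.sqrt y by rewrite sqr_sqrtr // sqrtr_ge0.
have z4 : z ^+ 4 = y by rewrite (exprM z 2 2) z2 sqr_sqrtr // ltW.
have : ln y <= 4 * (z - 1).
  by rewrite -z4 lnXn // -[_ *+ 4]mulr_natl ler_pM2l // ln_leB1.
rewrite -z2 => h.
have : (1 + ln y) ^+ 2 <= (4 * z) ^+ 2 by rewrite ler_sqr ?nnegrE; lra.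
lra.
Qed.

(** The square is dominated by a multiple of the square root of x / d, whose sum is O(x). No
    logarithm is lost, so the Moebius inversions stay O(1). *)
Lemma sum_sqr_1ln x : 1 <= x ->
  \sum_(1 <= d < (Num.truncn x).+1) (1 + ln (x / d%:R)) ^+ 2 <= 32 * x.
Proof.
move=> x1; have x0 : 0 < x by lra.
have nx : (Num.truncn x)%:R <= x by rewrite truncn_le ltW.
apply: (@le_trans _ _ (16 * Num.sqrt x * \sum_(1 <= d < (Num.truncn x).+1) (Num.sqrt
  (d%:R : R))^-1)).
  rewrite mulr_sumr; apply: ler_sum_nat => d /andP[d0 dn].
  have d0' : 0 < d%:R :> R by rewrite ltr0n.
  rewrite -mulrA -sqrtrV ?ler0n // -sqrtrM; last exact: ltW. apply: sqr_1ln_le.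
  rewrite ler_pdivlMr // mul1r (le_trans _ nx) // ler_nat.
  by rewrite ltnS in dn.
have := sum_inv_sqrt (Num.truncn x); set S := \sum_(1 <= d < _) _ => hS.
have h1 : Num.sqrt (Num.truncn x)%:R <= Num.sqrt x by apply: ler_wsqrtr.
have h2 := sqr_sqrtr (ltW x0).
have : 0 <= Num.sqrt x * (2 * Num.sqrt x - S) by rewrite mulr_ge0 ?sqrtr_ge0 //; lra.
rewrite -[in 32 * _]h2; lra.
Qed.

(* The term k / x cancels the constant left in the expansion of the transform;
   the remainder is small enough to be summed after Moebius inversion, which
   yields Mertens' estimate without a prior Chebyshev bound. *)
Lemma mertens_transform : exists g k C : R, 0 <= C /\ forall x, 1 <= x ->
  `|\sum_(1 <= n < (Num.truncn x).+1)
      (mertens (x / n%:R) - ln (x / n%:R) + g - k / (x / n%:R)) / n%:R|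
    <= C * (1 + ln x) / x.
Proof.
have [g Hg] := harmonic_asymp R; have [c Hc] := sum_ln_div_asymp R.
(* In 2 A - X H + g H with A = X^2 / 2 + c and H = X + g, the powers of X cancel and 2 c + g^2
   remains. *)
pose k := 2 * c + g ^+ 2.
exists g, k, (20 + 4 * `|g| + `|k|); split; first by rewrite !addr_ge0 // mulr_ge0.
move=> x x1; have x0 : 0 < x by lra.
have := Hg x x1; have := Hc x x1.
have /andP[nx xn] := truncn_itv (ltW x0).
set N := Num.truncn x in nx xn *.
set A := \sum_(1 <= n < N.+1) _; set H := \sum_(1 <= n < N.+1) _ => hA hH.
have -> : \sum_(1 <= n < N.+1)
      (mertens (x / n%:R) - ln (x / n%:R) + g - k / (x / n%:R)) / n%:R =
   2 * A - ln x * H + g * H - k * N%:R / x.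
  transitivity (\sum_(1 <= n < N.+1) (mertens (x / n%:R) / n%:R + ln n%:R / n%:R
     - ln x * n%:R^-1 + g * n%:R^-1 - k / x)).
    apply: eq_big_nat => n /andP[n0 _].
    have n0' : 0 < n%:R :> R by rewrite ltr0n.
    rewrite ln_div ?posrE //; field.
    by rewrite !gt_eqF.
  rewrite !big_split /= !sumrN sum_mertens_div ?ltW // -!mulr_sumr -/N -/A -/H.
  rewrite sumr_const_nat subSS subn0 -[x^-1 *+ N]mulr_natr; ring.
have X0 := ln_ge0 x1; move: hA hH X0; set X := ln x; set t := x^-1 => hA hH X0.
have t0 : 0 < t by rewrite invr_gt0.
have xt : x * t = 1 by rewrite divff ?gt_eqF.
have [a aE] : exists a, A = X ^+ 2 / 2 + c + a by exists (A - (X ^+ 2 / 2 + c)); lra.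
have [b bE] : exists b, H = X + g + b by exists (H - (X + g)); lra.
have -> : 2 * A - X * H + g * H - k * N%:R * t = 2 * a - X * b + g * b + k * ((x -
  N%:R) * t).
  by rewrite /k mulrBl xt aE bE; field.
have ha : `|a| <= 8 * (1 + X) * t by move: hA; rewrite aE; congr (`|_| <= _); ring.
have hb : `|b| <= 4 * t by move: hH; rewrite bE; congr (`|_| <= _); ring.
have hf : `|(x - N%:R) * t| <= t.
  have f0 : 0 <= x - N%:R by lra.
  rewrite ger0_norm; last by rewrite mulr_ge0 // ltW.
  rewrite ler_piMl; [by [] | exact: ltW |].
  by rewrite -natr1 in xn; lra.
apply: le_trans (ler_normD _ _) _; rewrite normrM.
have h1 : `|2 * a - X * b + g * b| <= 2 * (8 * (1 + X) * t) + X * (4 * t) + `|g| * (4 *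
  t).
  apply: le_trans (ler_normD _ _) _; rewrite lerD //; last by rewrite normrM ler_wpM2l.
  apply: le_trans (ler_normB _ _) _; rewrite lerD //.
    by rewrite normrM (ger0_norm (ler0n _ 2)) ler_wpM2l.
  by rewrite normrM (ger0_norm X0) ler_wpM2l.
have h2 : `|k| * `|(x - N%:R) * t| <= `|k| * t by rewrite ler_wpM2l.
apply: le_trans (lerD h1 h2) _.
have e1 : 0 <= `|k| * (X * t) by rewrite !mulr_ge0 // ltW.
have e2 : 0 <= `|g| * (X * t) by rewrite !mulr_ge0 // ltW.
have e3 : 0 <= X * t by rewrite !mulr_ge0 // ltW.
lra.
Qed.

End Selberg.

Section LogScale.
Variable R : realType.
Implicit Types (x y u : R) (n : nat).
Local Notation mangoldt := (mangoldt R).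
Local Notation mertens := (@mertens R).

(** Both bounds come from [mobius_transform] applied to the function h in [mertens_transform]: f = 1
    gives the first, f d = ln (x / d) the second. *)
Lemma selberg : exists g k C : R, forall x, 1 <= x ->
  `|mertens x - ln x + g - k / x| <= C /\
  `|ln x * (mertens x - ln x + g - k / x) +
    \sum_(1 <= n < (Num.truncn x).+1) mangoldt n / n%:R *
      (mertens (x / n%:R) - ln (x / n%:R) + g - k / (x / n%:R))| <= C.
Proof.
have [g [k [C [C0 H]]]] := mertens_transform R.
pose h x := mertens x - ln x + g - k / x.
exists g, k, (32 * C) => x x1; have x0 : 0 < x by lra.
rewrite -/(h x).
(* The condition on f covers both choices; combined with the error in [mertens_transform] it leaves
   the square summed in [sum_sqr_1ln]. *)
have bound (f : nat -> R) :
    (forall d, (0 < d)%N -> 1 <= x / d%:R -> `|f d| <= 1 + ln (x / d%:R)) ->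
    `|\sum_(1 <= n < (Num.truncn x).+1) h (x / n%:R) / n%:R *
      \sum_(d <- divisors n) (mobius d)%:~R * f d| <= 32 * C.
  move=> Hf; rewrite -mobius_transform; last exact: ltW.
  apply: le_trans (ler_norm_sum _ _ _) _.
  apply: (@le_trans _ _ (\sum_(1 <= d < (Num.truncn x).+1)
       C / x * (1 + ln (x / d%:R)) ^+ 2)); last first.
    rewrite -mulr_sumr mulrAC ler_pdivrMr // mulrC [32 * C]mulrC -mulrA.
    by rewrite [leLHS]mulrC ler_wpM2l // sum_sqr_1ln.
  apply: ler_sum_nat => d /andP[d0 dn].
  have d0' : 0 < d%:R :> R by rewrite ltr0n.
  have xd1 : 1 <= x / d%:R.
    rewrite ler_pdivlMr // mul1r; apply: (@le_trans _ _ (Num.truncn x)%:R).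
      by rewrite ler_nat -ltnS.
    by rewrite truncn_le ltW.
  have l0 := ln_ge0 xd1.
  have h1 := Hf d d0 xd1; have h2 := H _ xd1.
  rewrite !normrM [`|d%:R^-1|]ger0_norm ?invr_ge0 //.
  have h3 : `|(mobius d)%:~R| <= 1 :> R.
    by rewrite -intr_norm -[1]/(1%:~R) ler_int norm_mobius_le1.
  set L := ln _ in h1 h2 l0 *.
  apply: (@le_trans _ _ (1 * (1 + L) / d%:R * (C * (1 + L) / (x / d%:R)))).
    apply: ler_pM => //; first by rewrite !mulr_ge0 // invr_ge0.
    by rewrite ler_wpM2r ?invr_ge0 // ler_pM.
  rewrite (_ : _ * _ = C / x * (1 + L) ^+ 2) //.
  by field; rewrite !gt_eqF.
have first n (F : nat -> R) : (0 < n)%N ->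
    \sum_(1 <= i < n.+1) F i * (i == 1%N)%:R = F 1%N.
  move=> n0; rewrite big_ltn // eqxx mulr1 big_nat big1 ?addr0 // => i /andP[i1 _].
  by rewrite gtn_eqF ?mulr0.
have n1 := truncnN_gt0 x1.
split.
  have := bound (fun=> 1); rewrite (eq_big_nat _ _ (F2 := fun n => h (x / n%:R) / n%:R
    * (n == 1%N)%:R)).
    rewrite first // !divr1; apply=> d _ xd1.
    by rewrite normr1 lerDl ln_ge0.
  move=> n /andP[n0 _]; congr (_ * _); rewrite -sum_mobius //.
  by apply: eq_bigr => d _; rewrite mulr1.
have := bound (fun d => ln x - ln d%:R).
rewrite (eq_big_nat _ _ (F2 := fun n => (h (x / n%:R) / n%:R * ln x) * (n == 1%N)%:R
   + mangoldt n / n%:R * h (x / n%:R))).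
  rewrite big_split /= first // !divr1 mulrC; apply=> d d0 xd1.
  by rewrite -ln_div ?posrE ?ltr0n // ger0_norm ?ln_ge0 // lerDr.
move=> n /andP[n0 _].
under eq_bigr do rewrite mulrBr.
rewrite sumrB sum_mobius_ln // -mulr_suml sum_mobius //.
by ring.
Qed.

Lemma ler_mertens x y : x <= y -> mertens x <= mertens y.
Proof.
move=> xy; have := le_truncn xy; rewrite -ltnS => nm.
rewrite /mertens (big_cat_nat (isT : (1 <= (Num.truncn x).+1)%N) nm) /= lerDl.
by apply: sumr_ge0 => n _; rewrite divr_ge0 ?mangoldt_ge0.
Qed.

Lemma mertens_lt1 x : x < 1 -> mertens x = 0.
Proof. by rewrite ltNge -truncn_gt0 -eqn0Ngt /mertens => /eqP ->; rewrite big_nil. Qed.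

Lemma mertens_asymp : exists C : R, 0 <= C /\ forall x, 1 <= x -> `|mertens x - ln x|
  <= C.
Proof.
have [g [k [C H]]] := selberg; exists (`|C| + `|g| + `|k|); split.
  by rewrite !addr_ge0.
move=> x x1; have [{}H _] := H x x1; have x0 : 0 < x by lra.
have -> : mertens x - ln x = (mertens x - ln x + g - k / x) - g + k / x by ring.
apply: le_trans (ler_normD _ _) _; rewrite lerD //.
  apply: le_trans (ler_normB _ _) _; rewrite lerD //.
  exact: le_trans H (ler_norm _).
by rewrite normrM normfV (gtr0_norm x0) ler_pdivrMr // ler_peMr.
Qed.

(** On (N / 2, N] the factor N / n is at least 1, so the block is at most N times an increment of
    [mertens], which is O(1); the blocks add up geometrically. The bound serves to sum the terms k /
    (x / n) in Selberg's formula. *)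
Lemma chebyshev : exists C : R, 0 <= C /\ forall x, 1 <= x ->
  \sum_(1 <= n < (Num.truncn x).+1) mangoldt n <= C * x.
Proof.
have [C [C0 H]] := mertens_asymp; pose B := 2 + 2 * C.
have B0 : 0 <= B by rewrite /B; lra.
have step N : \sum_(1 <= n < N.+1) mangoldt n <= 2 * B * N%:R.
  elim/ltn_ind: N => N IH; case: (leqP N 1) => [N1|N2].
    apply: (@le_trans _ _ 0); last by rewrite !mulr_ge0.
    rewrite big_nat big1 // => n /andP[n0 nN].
    by rewrite (_ : n = 1%N) ?mangoldt1 //; lia.
  have hN : (N %/ 2 < N)%N by lia.
  have h0 : (0 < N %/ 2)%N by lia.
  rewrite (big_cat_nat (isT : (1 <= (N %/ 2).+1)%N) (ltnW hN : (N %/ 2).+1 <= N.+1)%N)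
    /=.
  have N0' : 0 < N%:R :> R by rewrite ltr0n; lia.
  have h0' : 0 < (N %/ 2)%:R :> R by rewrite ltr0n.
  have h3 : N%:R <= 3 * (N %/ 2)%:R :> R by rewrite -natrM ler_nat; lia.
  have h2 : 2 * (N %/ 2)%:R <= N%:R :> R by rewrite -natrM ler_nat; lia.
  have m1 : mertens N%:R - mertens (N %/ 2)%:R <= B.
    have := H N%:R; rewrite ler1n => /(_ (ltnW N2)).
    have := H (N %/ 2)%:R; rewrite ler1n => /(_ h0).
    have : ln N%:R - ln (N %/ 2)%:R <= 2 :> R.
      apply: le_trans (lnB_le h0' N0') _; rewrite ler_pdivrMr //; lra.
    rewrite !ler_norml /B; lra.
  have m2 : \sum_((N %/ 2).+1 <= n < N.+1) mangoldt n <= N%:R * B.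
    apply: (@le_trans _ _ (N%:R * (mertens N%:R - mertens (N %/ 2)%:R))); last first.
      by rewrite ler_wpM2l.
    rewrite /mertens !natrK.
    rewrite [X in _ * (X - _)](big_cat_nat (isT : (1 <= (N %/ 2).+1)%N) (ltnW hN : (N
      %/ 2).+1 <= N.+1)%N) /=.
    rewrite [X in _ * X]addrC addKr mulr_sumr; apply: ler_sum_nat => n /andP[n0 nN].
    have n0' : 0 < n%:R :> R by rewrite ltr0n; lia.
    rewrite mulrCA ler_peMr ?mangoldt_ge0 // ler_pdivlMr // mul1r ler_nat; lia.
  apply: le_trans (lerD (IH _ hN) m2) _.
  have : 0 <= B * (N%:R - 2 * (N %/ 2)%:R) by rewrite mulr_ge0 // subr_ge0.
  lra.
exists (2 * B); split; first by rewrite mulr_ge0.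
move=> x x1; apply: le_trans (step _) _; rewrite ler_wpM2l ?mulr_ge0 //.
by rewrite truncn_le; lra.
Qed.

End LogScale.

(** * The measure nu on the logarithmic scale *)

Section LogScale2.
Variable R : realType.
Implicit Types (x y u t : R) (n : nat).
Local Notation mangoldt := (mangoldt R).
Local Notation mertens := (@mertens R).

(** This is nu(0,t]; it vanishes for negative t, so windows below 0 count as empty. *)
Definition mass t := mertens (expR t).
Definition wt n : R := mangoldt n / n%:R.
(** The integral over (0,t] against nu, the integrand being a function of n instead of log n. *)
Definition wsum (F : nat -> R) t := \sum_(1 <= n < (Num.truncn (expR t)).+1) wt n * F n.

Lemma wt_ge0 n : 0 <= wt n.
Proof. by rewrite divr_ge0 ?mangoldt_ge0. Qed.

Lemma le_truncn_expR n t : (0 < n)%N -> (n <= Num.truncn (expR t))%N = (ln n%:R <= t).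
Proof.
move=> n0; rewrite truncn_ge_nat ?expR_ge0 // -ler_expR lnK // posrE ltr0n //.
Qed.

Lemma ler_mass s t : s <= t -> mass s <= mass t.
Proof. by move=> st; rewrite ler_mertens // ler_expR. Qed.

Lemma mass_lt0 t : t < 0 -> mass t = 0.
Proof. by move=> t0; rewrite /mass mertens_lt1 // expR_lt1. Qed.

Lemma mass_asymp : exists C : R, 0 <= C /\ forall t, 0 <= t -> `|mass t - t| <= C.
Proof.
have [C [C0 H]] := mertens_asymp R; exists C; split=> // t t0.
by have := H (expR t); rewrite expRK; apply; rewrite -expR0 ler_expR.
Qed.

Lemma wsumB (F : nat -> R) s t : s <= t ->
  wsum F t - wsum F s =
  \sum_((Num.truncn (expR s)).+1 <= n < (Num.truncn (expR t)).+1) wt n * F n.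
Proof.
move=> st; have h : (Num.truncn (expR s) <= Num.truncn (expR t))%N by rewrite le_truncn
  ?ler_expR.
rewrite -ltnS in h; rewrite /wsum (big_cat_nat (isT : (1 <= (Num.truncn (expR
  s)).+1)%N) h) /=.
by rewrite [LHS]addrC addKr.
Qed.

Lemma wsumB_le (F G : nat -> R) s t : s <= t ->
  (forall n, (0 < n)%N -> s < ln n%:R -> ln n%:R <= t -> wt n != 0 -> F n <= G n) ->
  wsum F t - wsum F s <= wsum G t - wsum G s.
Proof.
move=> st H; rewrite !wsumB //; apply: ler_sum_nat => n /andP[n1 n2].
have n0 : (0 < n)%N by lia.
have [->|w0] := eqVneq (wt n) 0; first by rewrite !mul0r.
rewrite ler_wpM2l ?wt_ge0 // H // -?le_truncn_expR // ltNge -le_truncn_expR //.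
by rewrite -ltnNge.
Qed.

Lemma wsum_le (F G : nat -> R) t :
  (forall n, (0 < n)%N -> ln n%:R <= t -> wt n != 0 -> F n <= G n) ->
  wsum F t <= wsum G t.
Proof.
move=> H; apply: ler_sum_nat => n /andP[n1 n2].
have [->|w0] := eqVneq (wt n) 0; first by rewrite !mul0r.
by rewrite ler_wpM2l ?wt_ge0 // H // -?le_truncn_expR.
Qed.

Lemma wsum_cst c t : wsum (fun=> c) t = c * mass t.
Proof. by rewrite /wsum -mulr_suml mulrC. Qed.

Lemma wsumD F G t : wsum (fun n => F n + G n) t = wsum F t + wsum G t.
Proof. by rewrite /wsum -big_split /=; apply: eq_bigr => n _; rewrite mulrDr. Qed.

Lemma wsumN F t : wsum (fun n => - F n) t = - wsum F t.
Proof. by rewrite /wsum -sumrN /=; apply: eq_bigr => n _; rewrite mulrN. Qed.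

Lemma wsum_eq F G t : (forall n, (0 < n)%N -> ln n%:R <= t -> F n = G n) ->
  wsum F t = wsum G t.
Proof.
move=> H; apply: eq_big_nat => n /andP[n1 n2]; rewrite H // -le_truncn_expR //.
Qed.

(** The difference of Selberg's formula at u + g and at u. The constants g0 and k only contribute
    bounded terms, by Mertens and Chebyshev. *)
Lemma selberg_mass G : 0 <= G -> exists C : R, forall u g, 0 <= u -> 0 <= g <= G ->
  `|u * (mass (u + g) - mass u) +
    wsum (fun n => mass (u + g - ln n%:R) - mass (u - ln n%:R)) (u + g)
    - 2 * u * g| <= C.
Proof.
move=> G0; have [g0 [k [C H]]] := selberg R; have [B [B0 HB]] := mass_asymp.
have [D [D0 HD]] := chebyshev R.
pose W u := wsum (fun n => mass (u - ln n%:R)) u.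
pose V u := wsum (fun n => u - ln n%:R) u.
pose K := C + `|k| + `|k| * D.
have Phi u : 0 <= u ->
   `|u * mass u - u ^+ 2 + g0 * u + W u - V u + g0 * mass u| <= K.
  move=> u0; have x1 : 1 <= expR u by rewrite -expR0 ler_expR.
  have x0 := expR_gt0 u.
  have [_ ] := H _ x1; rewrite expRK -/(mass u).
  rewrite (eq_big_nat _ _ (F2 := fun n => wt n * mass (u - ln n%:R) - wt n * (u - ln
    n%:R)
     + wt n * g0 - k / expR u * mangoldt n)); last first.
    move=> n /andP[n0 _]; have n0' : 0 < n%:R :> R by rewrite ltr0n.
    have e : expR u / n%:R = expR (u - ln n%:R) by rewrite expRB lnK.
    rewrite e expRK -/(mass _) -e /wt; field.
    by rewrite !gt_eqF.
  rewrite sumrB !big_split /= sumrN -mulr_sumr -mulr_suml -[\sum_(1 <= i < _) wt i *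
    mass _]/(W u)
    -[\sum_(1 <= i < _) wt i * (u - _)]/(V u) -[\sum_(1 <= i < _) wt i]/(mass u).
  have := HD _ x1; set P := \sum_(1 <= n < _) _ => hP h.
  have P0 : 0 <= P by apply: sumr_ge0 => n _; exact: mangoldt_ge0.
  have i0 : 0 <= (expR u)^-1 by rewrite invr_ge0 ltW.
  have h1 : `|k / expR u * u| <= `|k|.
    rewrite -mulrA normrM ler_piMr // ger0_norm ?mulr_ge0 //.
    rewrite mulrC ler_pdivrMr // mul1r; have := expR_ge1Dx u; lra.
  have h2 : `|k / expR u * P| <= `|k| * D.
    rewrite -mulrA normrM ler_wpM2l // ger0_norm ?mulr_ge0 //.
    by rewrite mulrC ler_pdivrMr.
  rewrite /K; set z := k / expR u * u in h1; set z' := k / expR u * P in h2.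
  move: h; rewrite -/z'.
  have -> : u * (mass u - u + g0 - k / expR u) = u * mass u - u ^+ 2 + g0 * u - z.
    by rewrite /z; ring.
  by move: h1 h2; rewrite !ler_norml; lra.
exists (2 * K + 2 * G ^+ 2 + 2 * B * G + `|g0| * (2 * G + 2 * B)).
move=> u g u0 /andP[g_ge0 gG].
have ug0 : 0 <= u + g by lra.
have := Phi _ u0; have := Phi _ ug0.
have mon : mass u <= mass (u + g) by rewrite ler_mass //; lra.
have -> : wsum (fun n => mass (u + g - ln n%:R) - mass (u - ln n%:R)) (u + g) =
    W (u + g) - W u.
  rewrite wsumD wsumN; congr (_ - _); apply/eqP; rewrite -subr_eq0; apply/eqP.
  rewrite wsumB; last lra.
  rewrite big_nat big1 // => n /andP[n1 n2].
  (* Extending the range of W u to u + g adds only zeros, as u - log n is negative there. *)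
  rewrite mass_lt0 ?mulr0 // subr_lt0 ltNge -le_truncn_expR; last lia.
  by rewrite -ltnNge; lia.
(* The increment of V cancels, up to O(1), the term g mass (u + g) that appears when u mass u is
   differenced. *)
have V1 : g * mass u <= V (u + g) - V u <= g * mass (u + g).
  have e : V (u + g) - V u = (wsum (fun n => u + g - ln n%:R) (u + g) -
     wsum (fun n => u + g - ln n%:R) u) + g * mass u.
    have -> : wsum (fun n => u + g - ln n%:R) u = V u + g * mass u.
      rewrite -wsum_cst -wsumD; apply: wsum_eq => n _ _; ring.
    by rewrite /V; ring.
  rewrite e; apply/andP; split.
    rewrite lerDr wsumB; last lra.
    rewrite big_nat; apply: sumr_ge0 => n /andP[n1 n2].
    rewrite mulr_ge0 ?wt_ge0 // subr_ge0 -le_truncn_expR; lia.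
  rewrite -lerBrDr -mulrBr mulrC.
  have -> : (mass (u + g) - mass u) * g = wsum (fun=> g) (u + g) - wsum (fun=> g) u.
    by rewrite !wsum_cst; ring.
  apply: wsumB_le; first lra.
  by move=> n n0 h1 h2 _; lra.
have dm : mass (u + g) - mass u <= G + 2 * B.
  by have := HB _ u0; have := HB _ ug0; rewrite !ler_norml; lra.
have : `|g0 * (g + (mass (u + g) - mass u))| <= `|g0| * (2 * G + 2 * B).
  by rewrite normrM ler_wpM2l // ger0_norm; lra.
have : 0 <= g * (mass (u + g) - mass u) <= G * (G + 2 * B).
  by rewrite mulr_ge0 ?ler_pM //; lra.
have : 0 <= g ^+ 2 <= G ^+ 2 by rewrite sqr_ge0 ler_sqr ?nnegrE.
move: V1; rewrite !ler_norml.
set a := mass (u + g); set b := mass u; set c := W _; set d := W _.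
set e := V _; set f := V _.
lra.
Qed.

End LogScale2.

(** * Primes in short intervals *)

Section MassGaps.
Variable R : realType.
Implicit Types (x y u t : R) (n : nat).
Local Notation mass := (@mass R).
Local Notation wsum := (@wsum R).

Lemma wsum_ge0 (F : nat -> R) t :
  (forall n, (0 < n)%N -> ln n%:R <= t -> 0 <= F n) -> 0 <= wsum F t.
Proof.
move=> H; rewrite -(mul0r (mass t)) -wsum_cst; apply: wsum_le => n n0 nt _.
exact: H.
Qed.

(** The integral in [selberg_mass] is nonnegative; dropping it and dividing by s leaves 2 g + C /
    s. *)
Lemma mass_upper G th : 0 <= G -> 0 < th -> exists A : R, 0 <= A /\
  forall s g, A <= s -> 0 <= g <= G -> mass (s + g) - mass s <= 2 * g + th.
Proof.
move=> G0 th0; have [C HC] := @selberg_mass R _ G0.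
exists (`|C| / th + 1); split; first by rewrite addr_ge0 // divr_ge0 // ltW.
move=> s g As gG.
have q0 : 0 <= `|C| / th by rewrite divr_ge0 // ltW.
have s0 : 0 < s by lra.
have := HC s g (ltW s0) gG.
have : 0 <= wsum (fun n => mass (s + g - ln n%:R) - mass (s - ln n%:R)) (s + g).
  by apply: wsum_ge0 => n _ _; rewrite subr_ge0 ler_mass //; lra.
set W := wsum _ _; set d := mass _ - mass _ => W0; rewrite ler_norml => /andP[_ h].
have Cs : C <= th * s.
  apply: le_trans (ler_norm _) _; rewrite mulrC -ler_pdivrMr //; lra.
rewrite -(ler_pM2l s0); lra.
Qed.

(** With a light window at u the integral in [selberg_mass] is at least 2 g u - th u - O(1), while
    the constant 2 g + th integrates to at most (2 g + th) u + O(1). Stopping at u - A confines the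
    reflected windows to the range where [mass_upper] makes the defect nonnegative. *)
Lemma mean_defect g th A : 0 <= g -> 0 < th -> 0 <= A -> exists U : R,
  forall u, U <= u -> mass (u + g) - mass u <= th ->
  wsum (fun n => 2 * g + th - (mass (u + g - ln n%:R) - mass (u - ln n%:R)))
    (u - A) <= 3 * th * u.
Proof.
move=> g0 th0 A0; have [B [B0 HB]] := mass_asymp R.
have [C HC] := @selberg_mass R _ g0.
pose c := g + 2 * B.
pose K := (2 * g + th) * B + C + c * (g + A + 2 * B).
exists (`|K| / th + A) => u Uu hu.
have q0 : 0 <= `|K| / th by rewrite divr_ge0 // ltW.
have u0 : 0 <= u by lra.
have uA0 : 0 <= u - A by lra.
have := HC u g u0; rewrite g0 lexx => /(_ isT).
set F := fun n : nat => _; rewrite ler_norml => /andP[hF _].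
have -> : wsum (fun n => 2 * g + th - (mass (u + g - ln n%:R) - mass (u - ln n%:R))) (u
  - A) =
    (2 * g + th) * mass (u - A) - wsum F (u - A).
  by rewrite (wsumD (fun=> _) (fun n => - F n)) wsumN wsum_cst.
have tail : wsum F (u + g) - wsum F (u - A) <= c * (g + A + 2 * B).
  apply: (@le_trans _ _ (wsum (fun=> c) (u + g) - wsum (fun=> c) (u - A))).
    apply: wsumB_le; first lra.
    move=> n n0 h1 h2 _; rewrite /F /c.
    have h3 : mass (u + g - ln n%:R) <= mass (g + Num.max (u - ln n%:R) 0).
      by rewrite ler_mass // (_ : u + g - _ = g + (u - ln n%:R)) ?lerD2l ?le_max ?lexx
        //; ring.
    case: (ltP (u - ln n%:R) 0) => s0.
      rewrite (mass_lt0 s0); move: h3; rewrite max_r ?addr0; last exact: ltW.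
      by have := HB _ g0; rewrite ler_norml; lra.
    move: h3; rewrite max_l // => h3.
    have := HB _ s0; have := HB (g + (u - ln n%:R)); rewrite addr_ge0 // => /(_ isT).
    by rewrite !ler_norml; lra.
  rewrite !wsum_cst -mulrBr ler_wpM2l // /c; first lra.
  have := HB _ uA0; have := HB (u + g); rewrite addr_ge0 // => /(_ isT).
  by rewrite !ler_norml; lra.
have h1 : (2 * g + th) * mass (u - A) <= (2 * g + th) * (u + B).
  rewrite ler_wpM2l //; first lra.
  by have := HB _ uA0; rewrite ler_norml; lra.
have h2 : u * (mass (u + g) - mass u) <= u * th by rewrite ler_wpM2l.
have h3 : K <= th * u.
  apply: le_trans (ler_norm _) _; rewrite mulrC -ler_pdivrMr //; lra.
rewrite /K in h3.
lra.
Qed.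

(** Pigeonhole: at least (T - U - l) / l disjoint windows of length l fit between U and T. *)
Lemma light_window (F : nat -> R) l c M U T : 0 < l -> 0 <= U ->
  (forall n, (0 < n)%N -> ln n%:R <= T -> 0 <= F n) ->
  wsum F T <= M -> M < (T - U - l) / l * c -> 0 <= c -> U <= T ->
  exists a, [/\ U <= a, a + l <= T & wsum F (a + l) - wsum F a < c].
Proof.
move=> l0 U0 F0 hM hc c0 UT; apply: contrapT => H.
have mon s t : s <= t -> t <= T -> wsum F s <= wsum F t.
  move=> st tT; rewrite -subr_ge0 -(subrr (wsum (fun=> 0) s)).
  have -> : wsum (fun=> 0) s - wsum (fun=> 0) s = wsum (fun=> 0) t - wsum (fun=> 0) s.
    by rewrite !wsum_cst; ring.
  apply: wsumB_le => // n n0 _ nt _; apply: F0 => //; exact: le_trans nt tT.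
have step k : U + k%:R * l <= T -> k%:R * c <= wsum F (U + k%:R * l).
  elim: k => [|k IH] hk.
    rewrite mul0r; apply: wsum_ge0 => n n0 nt; apply: F0 => //.
    exact: le_trans nt hk.
  have e : U + k.+1%:R * l = U + k%:R * l + l by rewrite -natr1; ring.
  rewrite e in hk *; have hk' : U + k%:R * l <= T by lra.
  have kl0 : 0 <= k%:R * l by rewrite mulr_ge0 // ltW.
  have : c <= wsum F (U + k%:R * l + l) - wsum F (U + k%:R * l).
    rewrite leNgt; apply/negP => hlt; apply: H; exists (U + k%:R * l); split=> //.
    lra.
  by have := IH hk'; rewrite -natr1; lra.
pose k := Num.truncn ((T - U) / l).
have TU : 0 <= (T - U) / l by rewrite divr_ge0 ?subr_ge0 // ltW.
have /andP[k1 k2] := truncn_itv TU; rewrite -/k in k1 k2.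
have hk : U + k%:R * l <= T by move: k1; rewrite ler_pdivlMr //; lra.
have := step k hk; have := mon _ _ hk (lexx _).
have : (T - U - l) / l * c <= k%:R * c.
  rewrite ler_wpM2r // ler_pdivrMr //.
  by move: k2; rewrite ltr_pdivrMr // -natr1; lra.
lra.
Qed.

(** If w - v <= g, the part of the heavy window beyond u - v is bounded by [mass_upper], so the rest
    is heavy. Otherwise the whole window lies in (u - w, u - v], and w - v exceeds g by at most 2
    e. *)
Lemma good_link g e A u v w :
  (forall s g', A <= s -> 0 <= g' <= g -> mass (s + g') - mass s <= 2 * g' + e) ->
  0 <= e -> v < w -> w <= v + g + 2 * e -> v <= u - A -> 0 <= g ->
  2 * g - e <= mass (u + g - w) - mass (u - w) ->
  2 * (w - v) - 6 * e <= mass (u - v) - mass (u - w).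
Proof.
move=> up e0 vw wv vu g0 good.
case: (leP (w - v) g) => [h|h].
  have := up (u - v) (g - (w - v)).
  have -> : u - v + (g - (w - v)) = u + g - w by ring.
  have h1 : A <= u - v by lra.
  have h2 : 0 <= g - (w - v) <= g by lra.
  by move=> /(_ h1 h2); lra.
have : mass (u + g - w) <= mass (u - v) by rewrite ler_mass //; lra.
lra.
Qed.

Lemma good_step (good : nat -> Prop) (f : R -> R) P a l :
  (forall b, a <= b -> b + P <= a + l ->
     exists n, [/\ (0 < n)%N, b < ln n%:R <= b + P & good n]) ->
  (forall n v, (0 < n)%N -> good n -> v < ln n%:R <= v + P -> ln n%:R <= a + l ->
     2 * (ln n%:R - v) - P / 4 <= f (ln n%:R) - f v) -> 0 <= P ->
  forall v, a <= v -> v + 2 * P <= a + l ->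
  exists n, [/\ (0 < n)%N, v + P < ln n%:R <= v + 2 * P &
    3 / 2 * (ln n%:R - v) <= f (ln n%:R) - f v].
Proof.
move=> cover link P0 v av vl.
have [|n1 [n10 /andP[vn1 n1v] gn1]] := cover v av; first lra.
(* Take the last good point at distance at most P from v: the next one lies
   beyond v + P, so two links always advance by at least P. *)
pose Q n := `[< (0 < n)%N /\ v < ln n%:R <= v + P /\ good n >].
have exQ : exists n, Q n by exists n1; apply/asboolP; rewrite vn1 n1v.
have ubQ n : Q n -> (n <= Num.truncn (expR (v + P)))%N.
  by move=> /asboolP[n0 [/andP[_ h] _]]; rewrite le_truncn_expR.
case: (ex_maxnP exQ ubQ) => n2 /asboolP[n20 [/andP[vn2 n2v] gn2]] mx.
have [||n3 [n30 /andP[vn3 n3v] gn3]] := cover (ln n2%:R); [lra | lra |].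
have h3 : v + P < ln n3%:R.
  rewrite ltNge; apply/negP => h.
  have : (n3 <= n2)%N by apply: mx; apply/asboolP; rewrite n30 h (lt_trans vn2 vn3).
  by rewrite -(ler_nat R) -ler_ln ?posrE ?ltr0n // leNgt vn3.
exists n3; split=> //; first by rewrite h3; lra.
have h12 : ln n2%:R <= a + l by lra.
have h13 : ln n3%:R <= a + l by lra.
(* The two links lose P / 4 each, in all at most half of the distance, which exceeds P: density 2
   becomes 3 / 2. *)
have := link n2 v n20 gn2; rewrite vn2 n2v => /(_ isT h12).
have := link n3 (ln n2%:R) n30 gn3; rewrite vn3 n3v => /(_ isT h13).
lra.
Qed.

(** Take u with a very light g-window and, by pigeonhole, an interval of length l whose total defect
    is below e d. A subinterval of length P has mass at least d, so without a good point its defect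
    would reach e d. *)
Lemma good_window g P e l : 0 < e -> 0 < g -> 0 < l ->
  (exists d U : R, 0 < d /\ forall u, U <= u -> d <= mass (u + P) - mass u) ->
  (forall d U : R, 0 < d -> exists2 u, U <= u & mass (u + g) - mass u < d) ->
  exists A u a, [/\ 0 <= A, a + l <= u - A,
    forall s g', A <= s -> 0 <= g' <= g -> mass (s + g') - mass s <= 2 * g' + e &
    forall b, a <= b -> b + P <= a + l -> exists n, [/\ (0 < n)%N,
      b < ln n%:R <= b + P &
      2 * g - e <= mass (u + g - ln n%:R) - mass (u - ln n%:R)]].
Proof.
move=> e0 g0 l0 [d [U1 [d0 H1]]] H2.
have l7 : 0 < 7 * l by lra.
(* This makes e d >= 7 l th, and the pigeonhole needs 3 u < 7 (u - A - U - l), where 3 is the factor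
   in [mean_defect]; u >= 8 (A + U + l) suffices. *)
pose th := Num.min e (e * d / (7 * l)).
have th0 : 0 < th by rewrite lt_min e0 /= divr_gt0 // mulr_gt0.
have the : th <= e by rewrite ge_min lexx.
have thd : 7 * l * th <= e * d by rewrite mulrC -ler_pdivlMr // ge_min lexx orbT.
move: th th0 the thd => th th0 the thd.
have [A [A0 up]] := mass_upper (ltW g0) th0.
have [U2 Hdef] := mean_defect (ltW g0) th0 A0.
have [U [U0 U1U]] : exists U : R, 0 <= U /\ U1 <= U.
  by exists (Num.max U1 0); rewrite !le_max !lexx orbT.
have [u uU hu] := H2 th (`|U2| + 8 * (A + U + l)) th0.
have U2n : U2 <= `|U2| by rewrite ler_norm.
have U2n0 : 0 <= `|U2| by rewrite normr_ge0.
have U2u : U2 <= u by lra.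
have hM := Hdef u U2u (ltW hu).
have {U2n U2n0 U2u Hdef} uU8 : 8 * (A + U + l) <= u by lra.
set D := fun n : nat => _ in hM *.
have D0 n : (0 < n)%N -> ln n%:R <= u - A -> 0 <= D n.
  move=> n0 nA; rewrite /D subr_ge0.
  have -> : u + g - ln n%:R = u - ln n%:R + g by ring.
  by apply: up; [lra | rewrite lexx ltW].
have [|||a [Ua aT hw]] := light_window l0 U0 D0 hM _ _ _ (c := e * d).
- apply: (@lt_le_trans _ _ ((u - A - U - l) / l * (7 * l * th))).
    have -> : (u - A - U - l) / l * (7 * l * th) = 7 * th * (u - A - U - l).
      by field; rewrite gt_eqF.
    have : 0 < th * (u * 4 - 7 * (A + U + l)) by rewrite mulr_gt0 //; lra.
    lra.
  by rewrite ler_wpM2l // divr_ge0 ?(ltW l0) //; lra.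
- by rewrite mulr_ge0 // ltW.
- lra.
exists A, u, a; split=> // [s g' As g'g|b ab bl].
  by apply: le_trans (up s g' As g'g) _; rewrite lerD2l.
clear uU8 hM thd hu uU H2 up.
apply: contrapT => hn; move: hw; apply/negP; rewrite -leNgt.
have mon s t : s <= t -> t <= u - A -> wsum (fun=> 0) t - wsum (fun=> 0) s <= wsum D t
  - wsum D s.
  by move=> st tT; apply: wsumB_le => // n n0 _ nt _; apply: D0 => //;
    exact: le_trans nt tT.
have bP : b <= b + P.
  rewrite lerDl leNgt; apply/negP => P0.
  have := H1 (Num.max U1 0) _; rewrite le_max lexx => /(_ isT).
  have : mass (Num.max U1 0 + P) <= mass (Num.max U1 0) by rewrite ler_mass // gerDl
    ltW.
  lra.
have bT : b <= u - A by lra.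
have h1 := mon a b ab bT; have h2 := mon (b + P) (a + l) bl aT.
have h3 : wsum (fun=> e) (b + P) - wsum (fun=> e) b <= wsum D (b + P) - wsum D b.
  apply: wsumB_le => // n n0 hb hP _; rewrite leNgt; apply/negP => hD; apply: hn.
  exists n; rewrite n0 hb hP; split=> //.
  by move: hD; rewrite /D; lra.
move: h1 h2 h3; rewrite !wsum_cst !mul0r subrr => h1 h2 h3.
have h5 := H1 b (le_trans U1U (le_trans Ua ab)).
have : e * d <= e * (mass (b + P) - mass b) by rewrite ler_wpM2l // ltW.
lra.
Qed.

Lemma no_max_gap G : 0 < G ->
  (exists d U : R, 0 < d /\ forall u, U <= u -> d <= mass (u + (G + G / 64)) - mass u)
    ->
  (forall d U : R, 0 < d -> exists2 u, U <= u & mass (u + (G - G / 64)) - mass u < d) ->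
  False.
Proof.
move=> G0 H1 H2; have [B [B0 HB]] := mass_asymp R.
(* P = g + 2 e is the longest link allowed in [good_link], and its loss 6 e stays below P / 4. *)
have [e [g [P [eE gE PE]]]] : exists e g P, [/\ e = G / 64, g = G - G / 64 & P = G + G
  / 64].
  by exists (G / 64), (G - G / 64), (G + G / 64).
rewrite -gE -PE in H1 H2.
have e0 : 0 < e by lra.
have P0 : 0 < P by lra.
have g0 : 0 < g by lra.
(* Over k steps the chain spans a distance D > 4 B with mass at least 3 D / 2, but [mass_asymp]
   allows only D + 2 B. The interval has length (2 k + 1) P: at most P to the first good point and 2
   P per step. *)
pose k := (Num.truncn (4 * B / P)).+1.
have kP : 4 * B < k%:R * P by have := truncnS_gt (4 * B / P); rewrite -/k ltr_pdivrMr.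
have l0 : 0 < (2 * k%:R + 1) * P by rewrite mulr_gt0 // ltr_pwDr // mulr_ge0.
have [A [u [a [A0 aT up cover]]]] := good_window e0 g0 l0 H1 H2.
clear H1 H2 l0; move: k kP aT cover => k kP aT cover.
pose good n := 2 * g - e <= mass (u + g - ln n%:R) - mass (u - ln n%:R).
have link n v : (0 < n)%N -> good n -> v < ln n%:R <= v + P ->
     ln n%:R <= a + (2 * k%:R + 1) * P ->
     2 * (ln n%:R - v) - P / 4 <= - mass (u - ln n%:R) - - mass (u - v).
  move=> n0 gn /andP[vn nv] nl.
  have h1 : ln n%:R <= v + g + 2 * e by lra.
  have h2 : v <= u - A by lra.
  have := good_link up (ltW e0) vn h1 h2 (ltW g0) gn.
  lra.
have kP0 : 0 <= k%:R * P by rewrite mulr_ge0 // ltW.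
have [||n0 [n00 /andP[an0 n0a] _]] := cover a; [lra | lra |].
have iter j : (j <= k)%N -> exists n, [/\ (0 < n)%N,
    ln n0%:R + j%:R * P <= ln n%:R <= a + P + j%:R * (2 * P) &
    3 / 2 * (ln n%:R - ln n0%:R) <= - mass (u - ln n%:R) - - mass (u - ln n0%:R)].
  elim: j => [|j IH] jk.
    by exists n0; rewrite !mul0r !addr0 n0a lexx !subrr mulr0 lexx.
  have [n [nn0 /andP[h1 h2] h3]] := IH (ltnW jk).
  have jk' : j%:R * P + P <= k%:R * P.
    by rewrite -{2}[P]mul1r -mulrDl ler_wpM2r ?(ltW P0) // natr1 ler_nat.
  have jP : 0 <= j%:R * P by rewrite mulr_ge0 // ltW.
  have [||m [m0 /andP[h4 h5] h6]] := good_step cover link (ltW P0) (v := ln n%:R).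
  - lra.
  - lra.
  exists m; split=> //; last lra.
  by rewrite -natr1; lra.
have [n [nn0 /andP[h1 h2] h3]] := iter k (leqnn k).
have h4 : 0 <= u - ln n%:R by lra.
have h5 : 0 <= u - ln n0%:R by lra.
have := HB _ h4; have := HB _ h5; rewrite !ler_norml.
lra.
Qed.

(** [E] collects the lengths whose windows are arbitrarily light arbitrarily far out. A window of
    length h has mass at least h - 2 B, so [E] is bounded, and a positive supremum is the critical
    length refuted by [no_max_gap]. *)
Lemma mass_gap g : 0 < g ->
  exists d U : R, 0 < d /\ forall u, U <= u -> d <= mass (u + g) - mass u.
Proof.
move=> g0; apply: contrapT => Hg; have [B [B0 HB]] := mass_asymp R.
pose E : set R := [set h | forall d U : R, 0 < d -> exists2 u, U <= u & mass (u + h) -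
  mass u < d].
have notE h : ~ (exists d U : R, 0 < d /\ forall u, U <= u -> d <= mass (u + h) - mass
  u) -> E h.
  move=> H d U d0; apply: contrapT => K; apply: H; exists d, U; split=> // u Uu.
  by rewrite leNgt; apply/negP => h'; apply: K; exists u.
have Eg : E g by apply: notE.
have ubE : ubound E (2 * B + 1).
  move=> h /(_ 1 `|h| ltr01) [u uh hu].
  have u0 : 0 <= u by exact: le_trans (normr_ge0 _) uh.
  have h0 : 0 <= u + h by move: uh; rewrite ler_norml; lra.
  by have := HB _ u0; have := HB _ h0; rewrite !ler_norml; lra.
have hsE : has_ubound E by exists (2 * B + 1).
have gS : g <= sup E by apply: ub_le_sup.
have S0 : 0 < sup E by lra.
apply: (no_max_gap S0).
  apply: contrapT => /notE /(ub_le_sup hsE); lra.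
have [|h Eh hS] := @sup_adherent R E (sup E / 64) _ (conj (ex_intro _ g Eg) hsE);
  first lra.
move=> d U d0; have [u Uu hu] := Eh d U d0; exists u => //; apply: le_lt_trans hu.
by rewrite lerD2r ler_mass //; lra.
Qed.

End MassGaps.

(** * From mass to primes *)

Section ShortIntervals.
Variable R : realType.

(** Only proper prime powers contribute. Their bases are at most the square root of y and pairwise
    distinct, because y <= 2 x; each term is at most ln y / x = O(y^(1/4) / x). *)
Lemma prime_free_mass (x y : R) : 1 <= x -> x <= y -> y <= 2 * x ->
  (forall p, prime p -> ~ (x < p%:R <= y)) ->
  mertens y - mertens x <= 16 / Num.sqrt (Num.sqrt y).
Proof.
move=> x1 xy y2x H.
have x0 : 0 < x by lra. have y0 : 0 < y by lra. have y1 : 1 <= y by lra.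
set N := Num.truncn x; set M := Num.truncn y.
have NM : (N <= M)%N by apply: le_truncn.
have [Nx xN] : N%:R <= x /\ x < N.+1%:R by split;
  [rewrite truncn_le ltW | exact: truncnS_gt].
have My : M%:R <= y by rewrite truncn_le ltW.
pose z := Num.sqrt (Num.sqrt y).
have z0 : 0 < z by rewrite !sqrtr_gt0.
have z2 : z ^+ 2 = Num.sqrt y by rewrite sqr_sqrtr // sqrtr_ge0.
have z4 : z ^+ 4 = y by rewrite (exprM z 2 2) z2 sqr_sqrtr // ltW.
have lny : 0 <= ln y <= 4 * z.
  rewrite ln_ge0 //=; have := sqr_1ln_le y1; rewrite -z2 => h.
  have : (1 + ln y) ^+ 2 <= (4 * z) ^+ 2 by lra.
  by rewrite ler_sqr ?nnegrE; have := ln_ge0 y1; lra.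
have -> : mertens y - mertens x = \sum_(N.+1 <= n < M.+1) mangoldt R n / n%:R.
  rewrite /mertens -/N -/M (big_cat_nat (isT : (1 <= N.+1)%N) (NM : (N.+1 <= M.+1)%N))
    /=.
  by rewrite [LHS]addrC addKr.
pose s := [seq n <- index_iota N.+1 M.+1 | mangoldt R n != 0].
have sP n : n \in s -> [/\ x < n%:R, n%:R <= y & exists p k, [/\ prime p, (1 < k)%N, n
  = (p ^ k)%N & mangoldt R n = ln p%:R]].
  rewrite mem_filter mem_index_iota ltnS => /andP[/mangoldt_neq0[p [k [pp k0 nE ->]]]
    /andP[Nn nM]].
  have xn : x < n%:R by apply: lt_le_trans xN _; rewrite ler_nat.
  have ny : n%:R <= y by apply: le_trans My; rewrite ler_nat.
  split=> //; exists p, k; split=> //; case: k k0 nE => [|[|k]] // _ nE.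
  by case: (H p pp); rewrite -[p]expn1 -nE xn ny.
have sz : (size s <= (Num.truncn (Num.sqrt y)).+1)%N.
  rewrite -(size_iota 0 (Num.truncn (Num.sqrt y)).+1) -(size_map pdiv s).
  apply: uniq_leq_size.
    rewrite map_inj_in_uniq ?filter_uniq ?iota_uniq //.
    move=> a b /sP[xa ay [p [k [pp k1 aE _]]]] /sP[xb yb [q [l [qp l1 bE _]]]].
    have -> : pdiv a = p by rewrite aE -(prednK (ltnW k1)) pdiv_pfactor.
    have -> : pdiv b = q by rewrite bE -(prednK (ltnW l1)) pdiv_pfactor.
    move=> pq.
    have grow i j c d : c = (p ^ i)%N -> d = (p ^ j)%N -> x < c%:R -> d%:R <= y -> (j
      <= i)%N.
      move=> cE dE xc dy; rewrite leqNgt; apply/negP => ij.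
      have : (2 * c <= d)%N.
        rewrite cE dE; apply: leq_trans (leq_mul (prime_gt1 pp) (leqnn _)) _.
        by rewrite -expnS leq_exp2l ?prime_gt1.
      rewrite -(ler_nat R) natrM; lra.
    rewrite -pq in bE; rewrite aE bE; congr (_ ^ _)%N; apply/eqP.
    by rewrite eqn_leq (grow _ _ _ _ bE aE xb ay) (grow _ _ _ _ aE bE xa yb).
  move=> _ /mapP[n /sP[xn ny [p [k [pp k1 nE _]]]] ->].
  rewrite mem_iota /= add0n ltnS nE -(prednK (ltnW k1)) pdiv_pfactor //.
  rewrite truncn_ge_nat ?sqrtr_ge0 // -ler_sqr ?nnegrE ?sqrtr_ge0 // (sqr_sqrtr (ltW
    y0)).
  by apply: le_trans ny; rewrite -natrX ler_nat nE leq_exp2l // prime_gt1.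
have -> : \sum_(N.+1 <= n < M.+1) mangoldt R n / n%:R = \sum_(n <- s) mangoldt R n /
  n%:R.
  rewrite big_filter [RHS]big_mkcond /=; apply: eq_bigr => n _.
  by case: eqVneq => [->|]; rewrite ?mul0r.
apply: (@le_trans _ _ (\sum_(n <- s) ln y / x)).
  rewrite big_seq [leRHS]big_seq; apply: ler_sum => n /sP[xn ny [p [k [pp k1 nE ->]]]].
  have n0 : 0 < n%:R :> R by lra.
  have pn : p%:R <= y.
    by apply: le_trans ny; rewrite ler_nat nE -{1}[p]expn1 leq_exp2l ?prime_gt1 // ltnW.
  apply: ler_pM.
  - by rewrite ln_ge0 // ler1n prime_gt0.
  - by rewrite invr_ge0 ltW.
  - by rewrite ler_ln ?posrE // ltr0n prime_gt0.
  - by rewrite lef_pV2 ?posrE // ltW.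
rewrite big_const_seq count_predT iter_addr_0 -[_ *+ size s]mulr_natr.
have sz' : (size s)%:R <= 2 * z ^+ 2.
  apply: (@le_trans _ _ ((Num.truncn (Num.sqrt y)).+1%:R)); first by rewrite ler_nat.
  have : (Num.truncn (Num.sqrt y))%:R <= Num.sqrt y by rewrite truncn_le sqrtr_ge0.
  have : 1 <= Num.sqrt y by rewrite -sqrtr1 ler_wsqrtr.
  by rewrite z2 -natr1; lra.
rewrite -/z ler_pdivlMr //.
have h1 : ln y / x * (size s)%:R <= (4 * z) / x * (2 * z ^+ 2).
  have /andP[l0 l1] := lny.
  apply: ler_pM => //; first by rewrite divr_ge0 // ltW.
  by rewrite ler_wpM2r // invr_ge0 ltW.
apply: le_trans (ler_wpM2r (ltW z0) h1) _.
rewrite [leLHS](_ : _ = 8 * (z ^+ 4 / x)); last by ring.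
rewrite z4; have : y / x <= 2 by rewrite ler_pdivrMr.
lra.
Qed.

Lemma prime_short_interval (e : R) : 0 < e -> exists X : R, forall x, X <= x ->
  exists2 p, prime p & x < p%:R <= (1 + e) * x.
Proof.
(* Capping e at 1 keeps the interval within the factor 2 of [prime_free_mass]. *)
move=> e0; pose e' := Num.min e 1.
have e'0 : 0 < e' by rewrite lt_min e0 ltr01.
have e'e : e' <= e by rewrite ge_min lexx.
have e'1 : e' <= 1 by rewrite ge_min lexx orbT.
have [|d [U [d0 HU]]] := @mass_gap R (ln (1 + e')); first by rewrite ln_gt0; lra.
exists (Num.max (expR U) ((16 / d) ^+ 4 + 1)) => x; rewrite ge_max => /andP[xU xd].
have q0 : 0 < 16 / d by rewrite divr_gt0.
have q4 : 0 < (16 / d) ^+ 4 by rewrite exprn_gt0.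
have x0 : 0 < x by lra.
have x1 : 1 <= x by lra.
apply: contrapT => H.
have xy : x <= (1 + e') * x by rewrite ler_peMl; lra.
have := @prime_free_mass x ((1 + e') * x) x1 xy.
have y2 : (1 + e') * x <= 2 * x by rewrite ler_wpM2r; lra.
have np p : prime p -> ~ (x < p%:R <= (1 + e') * x).
  move=> pp /andP[xp px]; apply: H; exists p => //; rewrite xp /=.
  apply: le_trans px _; rewrite ler_wpM2r; lra.
move=> /(_ y2 np).
have := HU (ln x); rewrite -ler_expR lnK ?posrE // => /(_ xU).
have -> : mass (ln x + ln (1 + e')) = @mertens R ((1 + e') * x).
  have e1 : 0 < 1 + e' by rewrite addr_gt0.
  by rewrite /mass expRD !lnK ?posrE // mulrC.
rewrite /mass lnK ?posrE // => h1 h2.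
have y0 : 0 < (1 + e') * x by lra.
pose z := Num.sqrt (Num.sqrt ((1 + e') * x)).
have z0 : 0 < z by rewrite !sqrtr_gt0.
have z4 : z ^+ 4 = (1 + e') * x by rewrite (exprM z 2 2) !sqr_sqrtr ?sqrtr_ge0 // ltW.
have : 16 / d < z.
  rewrite -(@ltr_pXn2r _ 4) ?nnegrE ?ltW // z4; lra.
rewrite ltr_pdivrMr // => h3.
have : d <= 16 / z by apply: le_trans h1 h2.
rewrite ler_pdivlMr //; lra.
Qed.

End ShortIntervals.

(** * The asymptotic lower bound *)

Section Asymptotics.
Variable R : realType.
Local Notation K := (4 * 2 `^ (1 / 5) / 5 `^ (6 / 5) : R).

(** For z = n, the base of the sixth power is the real solution q of 5 q^5 = 2 n, so this is the
    edge count 2 q^6 at the ideal q. *)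
Lemma const_mul_powR (z : R) : 0 <= z -> K * z `^ (6 / 5) = 2 * ((2 / 5 * z) `^ (1 /
  5)) ^+ 6.
Proof.
move=> z0; rewrite -powR_mulrn ?powR_ge0 // -powRrM.
have -> : 1 / 5 * 6%:R = 6 / 5 :> R by lra.
rewrite powRM //; last by rewrite divr_ge0.
have inv5 : 5^-1 `^ (6 / 5) = (5 `^ (6 / 5))^-1 :> R by rewrite -powRN -mulN1r
  [RHS]powRrM powR_inv1.
rewrite powRM ?invr_ge0 // inv5.
have -> : 2 `^ (6 / 5) = 2 * 2 `^ (1 / 5) :> R.
  have -> : 6 / 5 = 1 + 1 / 5 :> R by lra.
  by rewrite powRD ?powRr1 // pnatr_eq0 implybT.
by ring.
Qed.

Lemma bernoulli (e : R) n : 0 <= e <= 1 -> 1 - n%:R * e <= (1 - e) ^+ n.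
Proof.
move=> /andP[e0 e1]; elim: n => [|n IH]; first by rewrite mul0r subr0 expr0.
rewrite exprS -natr1.
have : (1 - e) * (1 - n%:R * e) <= (1 - e) * (1 - e) ^+ n by rewrite ler_wpM2l //
  subr_ge0.
have : 0 <= n%:R * (e * e) by rewrite !mulr_ge0.
lra.
Qed.

(** The 7 counts factors 1 - e: six from taking a prime q > y / (1 + e) in place of the ideal value
    y, one from absorbing q^3 into q^6. *)
Lemma exhat_lower (e : R) : 0 < e -> e <= 1 -> exists N, forall n, (N <= n)%N ->
  (1 - 7 * e) * (K * n%:R `^ (6 / 5)) <= (exhat n 1 10)%:R.
Proof.
move=> e0 e1; have [X HX] := prime_short_interval e0.
have ie0 : 0 < e^-1 by rewrite invr_gt0.
(* The summand 3 excludes q = 2, and the inverse of e ensures e x >= 1, which absorbs the cubic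
   term. *)
pose x0 := `|X| + 3 + e^-1.
have x03 : 3 <= x0 by rewrite /x0; have := normr_ge0 X; lra.
have x0e : e^-1 <= x0 by rewrite /x0; have := normr_ge0 X; lra.
have x0X : X <= x0 by rewrite /x0; have := ler_norm X; lra.
exists (Num.truncn (5 * ((1 + e) * x0) ^+ 5)).+1 => n hn.
have n_gt : 5 * ((1 + e) * x0) ^+ 5 <= n%:R.
  by apply: le_trans (ltW (truncnS_gt _)) _; rewrite ler_nat.
rewrite const_mul_powR //; set y := (_ `^ _).
have y5 : y ^+ 5 = 2 / 5 * n%:R.
  rewrite -powR_mulrn ?powR_ge0 // -powRrM.
  by rewrite (_ : 1 / 5 * 5%:R = 1) ?powRr1 ?mulr_ge0 //; lra.
have y0 : 0 <= y by exact: powR_ge0.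
have yx : (1 + e) * x0 <= y.
  rewrite -(@ler_pXn2r _ 5) ?nnegrE // ?mulr_ge0 //; try lra.
  have : 0 <= ((1 + e) * x0) ^+ 5 by rewrite exprn_ge0 // mulr_ge0; lra.
  lra.
pose x := y / (1 + e).
have e1' : 0 < 1 + e by lra.
have xx0 : x0 <= x by rewrite /x ler_pdivlMr // mulrC.
have [q pq /andP[xq qy]] := HX x (le_trans x0X xx0).
have qy' : q%:R <= y by move: qy; rewrite /x mulrC divfK // gt_eqF.
have oq : odd q.
  by have [q2|//] := even_prime pq; move: xq; rewrite q2; lra.
have q1 : 1 <= q%:R :> R by lra.
have le3 : (q ^ 3 <= q ^ 6)%N by rewrite leq_pexp2l ?prime_gt0.
have hq : (5 * q ^ 5 <= 2 * n)%N.
  rewrite -(ler_nat R) natrM natrX natrM.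
  have : q%:R ^+ 5 <= y ^+ 5 by rewrite lerXn2r ?nnegrE.
  by rewrite y5; lra.
have := exhat_prime_ge pq oq hq; rewrite -(ler_nat R) natrM natrB // !natrX => h.
apply: le_trans h.
have x1 : (1 - e) * y <= x.
  rewrite /x ler_pdivlMr //.
  have : 0 <= e * e * y by rewrite !mulr_ge0 // ltW.
  lra.
have xpos : 0 < x by lra.
have x6 : x ^+ 6 * (1 - e) <= q%:R ^+ 6 - q%:R ^+ 3.
  have h3 : x ^+ 3 <= q%:R ^+ 3 by rewrite lerXn2r ?nnegrE // ltW.
  have xe : 1 <= e * x.
    by rewrite mulrC -ler_pdivrMr // div1r; lra.
  have x31 : 1 <= e * x ^+ 3.
    have : 1 <= x ^+ 2 by rewrite exprn_ege1 //; lra.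
    have -> : e * x ^+ 3 = e * x * x ^+ 2 by ring.
    by move=> ?; rewrite mulr_ege1.
  have x3 : 0 < x ^+ 3 by rewrite exprn_gt0.
  have : 0 <= (q%:R ^+ 3 - x ^+ 3) * (q%:R ^+ 3 + x ^+ 3 - 1).
    rewrite mulr_ge0 ?subr_ge0 //.
    have : 1 <= q%:R ^+ 3 :> R by rewrite exprn_ege1.
    lra.
  have : 0 <= x ^+ 3 * (e * x ^+ 3 - 1) by rewrite mulr_ge0 ?subr_ge0 // ltW.
  lra.
have b7 : 1 - 7 * e <= (1 - e) ^+ 7 by apply: bernoulli; rewrite ltW.
have y6 : 0 <= y ^+ 6 by rewrite exprn_ge0.
have h1 : (1 - 7 * e) * y ^+ 6 <= (1 - e) ^+ 7 * y ^+ 6 by rewrite ler_wpM2r.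
have h2 : ((1 - e) * y) ^+ 6 * (1 - e) <= x ^+ 6 * (1 - e).
  rewrite ler_wpM2r ?subr_ge0 // lerXn2r ?nnegrE ?(ltW xpos) //.
  by rewrite mulr_ge0 // subr_ge0.
have h3 : ((1 - e) * y) ^+ 6 * (1 - e) = (1 - e) ^+ 7 * y ^+ 6 by ring.
rewrite mulrCA ler_wpM2l // (le_trans h1) // -h3.
exact: le_trans h2 x6.
Qed.

End Asymptotics.

Theorem theorem6p1 (R : realType) :
  (forall q : nat, prime q -> odd q ->
     exists (V : finType) (Q : signed_graph V),
       [/\ graph_iso (DC Q) (B5_clone4 q),
           #|V|%:R = (5 * q%:R ^+ 5 - q%:R ^+ 2 - 4 * q%:R) / 2 :> rat,
           #|edges Q|%:R = 2 * (q%:R ^+ 6 - q%:R ^+ 3) :> rat,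
           ~ contains_C (-1) 5 Q &
           ~ contains_C 1 10 Q]) /\
  (exists2 o : nat -> R, o n @[n --> \oo] --> 0 &
     forall n : nat,
       (4 * 2 `^ (1 / 5) / 5 `^ (6 / 5) - o n) * n%:R `^ (6 / 5)
         <= (exhat n 1 10)%:R).
Proof.
split; first exact: Q5_spec.
set K := (4 * _ / _).
have K0 : 0 <= K by rewrite divr_ge0 ?mulr_ge0 ?powR_ge0.
(* The positive part of the deficit: it tends to 0 by the lower bound alone, even where the ratio
   exceeds K. *)
pose o n : R := Num.max 0 (K - (exhat n 1 10)%:R / n%:R `^ (6 / 5)).
have powR_nat_gt0 n : (0 < n)%N -> 0 < n%:R `^ (6 / 5) :> R.
  by move=> n0; rewrite powR_gt0 // ltr0n.
exists o => [|n]; last first.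
  have [->|n0] := posnP n.
    rewrite powR0 ?mulr0 //; lra.
  rewrite -ler_pdivlMr ?powR_nat_gt0 // lerBlDr -lerBlDl.
  by rewrite /o le_max lexx orbT.
apply/cvgrPdist_le => e e0.
pose d := Num.min 1 (e / (7 * K + 1)).
have K1 : 0 < 7 * K + 1 by lra.
have d0 : 0 < d by rewrite lt_min ltr01 divr_gt0.
have d1 : d <= 1 by rewrite ge_min lexx.
have de : d * (7 * K + 1) <= e by rewrite -ler_pdivlMr // ge_min lexx orbT.
have [N HN] := exhat_lower d0 d1.
exists N.+1 => // n /= Nn; have n0 : (0 < n)%N by exact: leq_ltn_trans Nn.
have := HN n (ltnW Nn); rewrite -/K mulrA -ler_pdivlMr ?powR_nat_gt0 // => h.
rewrite sub0r normrN ger0_norm; last by rewrite le_max lexx.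
rewrite ge_max ltW //= lerBlDr.
have : 0 <= d by rewrite ltW.
lra.
Qed.
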